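(* Let $\bar L:G\times\mathfrak g\to\mathbb R$ be a Lagrangian. Then the set $$S=\{p\in{}^1TT^*G:\ \big(({}^1T\pi_G)^*d\bar L\big)(p)=\theta_2(p)\}$$ defined by the equation $({}^1T\pi_G)^*d\bar L=\theta_2$ is a Lagrangian submanifold of $({}^1TT^*G,\Omega_{{}^1TT^*G})$, and it gives the trivialized Euler-Lagrange equations $$\frac{d}{dt}\frac{\delta\bar L}{\delta\xi}=T_e^*R_g\frac{\delta\bar L}{\delta g}+ad^*_\xi\frac{\delta\bar L}{\delta\xi};$$ that is, a curve $(g(t),\mu(t))$ in $G\times\mathfrak g^*$ has trivialized velocity lying in $S$ for all $t$ if and only if, with $\xi(t)=T_gR_{g^{-1}}\dot g(t)$, one has $\mu=\frac{\delta\bar L}{\delta\xi}(g,\xi)$ and the trivialized Euler-Lagrange equations hold along $(g(t),\xi(t))$.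
   Context: $G$ is a Lie group with identity $e$, and $\mathfrak g\simeq T_eG$ is its Lie algebra, assumed reflexive, with dual $\mathfrak g^*$. $R_g$ is right multiplication. The bracket on $\mathfrak g$ is that of right invariant vector fields: $X^G_{[\xi,\eta]}=[X^G_\xi,X^G_\eta]_{JL}$ (Jacobi-Lie bracket), where $X^G_\xi(g)=T_eR_g\xi$. $\langle ad^*_\xi\mu,\eta\rangle=\langle\mu,[\xi,\eta]\rangle$. $T_e^*R_g:T_g^*G\to\mathfrak g^*$ is the dual of $T_eR_g$. $\delta\bar L/\delta g\in T_g^*G$ and $\delta\bar L/\delta\xi\in\mathfrak g^*$ are partial derivatives. The trivialized Tulczyjew's symplectic space is, as a manifold, ${}^1TT^*G=(G\times\mathfrak g^* )\times(\mathfrak g\times\mathfrak g^* )$ with points $(g,\mu,\xi,\nu)$. It is identified with $T(G\times\mathfrak g^* )$ by the trivialization $$(V_g,V_\mu)\in T_{(g,\mu)}(G\times\mathfrak g^* )\ \mapsto\ \big(g,\mu,\xi,V_\mu-ad^*_\xi\mu\big),\qquad \xi=T_gR_{g^{-1}}V_g.$$ The trivialized velocity of a curve $(g(t),\mu(t))$ is the image of $(\dot g,\dot\mu)$ under this map. The projection is ${}^1T\pi_G:{}^1TT^*G\to G\times\mathfrak g$, $(g,\mu,\xi,\nu)\mapsto(g,\xi)$. At a point $(g,\mu,\xi,\nu)$ every tangent vector is uniquely of the form $$X_{(\xi_2,\nu_2,\xi_3,\nu_3)}=\big(T_eR_g\xi_2,\ \nu_2+ad^*_{\xi_2}\mu,\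 \xi_3+[\xi,\xi_2],\ \nu_3+ad^*_{\xi_2}\nu-ad^*_\xi\nu_2\big)$$ with $\xi_2,\xi_3\in\mathfrak g$, $\nu_2,\nu_3\in\mathfrak g^*$. The one-form $\theta_2$ is defined by $$\langle\theta_2,X_{(\xi_2,\nu_2,\xi_3,\nu_3)}\rangle=\langle\mu,\xi_3\rangle+\langle\nu,\xi_2\rangle+\langle\mu,[\xi,\xi_2]\rangle,$$ and the symplectic two-form is $\Omega_{{}^1TT^*G}=d\theta_2$. *)

(* Defs.v *)
From HB Require Import structures.
From mathcomp Require Import all_boot all_order all_algebra.
From mathcomp Require Import all_classical all_reals.
From mathcomp Require Import topology normedtype derive.

Set Implicit Arguments.
Unset Strict Implicit.
Unset Printing Implicit Defensive.

Import Order.TTheory GRing.Theory Num.Theory numFieldNormedType.Exports.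

Local Open Scope classical_set_scope.
Local Open Scope ring_scope.

Section ContinuousLinearMaps.
Context {R : realType} {E F : normedModType R}.

Definition clm_pred : {pred E -> F} :=
  [pred f | `[< linear f /\ continuous f >]].

Record clm := Clm { clm_fun :> E -> F; _ : clm_fun \in clm_pred }.

HB.instance Definition _ := [isSub for clm_fun].
HB.instance Definition _ := [Choice of clm by <:].

Lemma clm_pred_closed : GRing.submod_closed clm_pred.
Proof.
split=> [|a f g]; rewrite !inE.
  split=> [b x y|]; last exact: cst_continuous.
  by rewrite [RHS]addr0 scaler0.
move=> [lf cf] [lg cg]; split=> [b x y|x].
  have E1 z : (a *: f + g) z = a *: f z + g z by [].
  by rewrite !E1 lf lg !scalerDr !scalerA mulrC addrACA.
by apply: continuousD; [apply: continuousZr; exact: cf|exact: cg].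
Qed.

HB.instance Definition _ := GRing.isSubmodClosed.Build _ _ clm_pred
  clm_pred_closed.
HB.instance Definition _ := [SubChoice_isSubLmodule of clm by <:].

Lemma clm_linear (f : clm) : linear f.
Proof. by case: f => f /=; rewrite inE => -[]. Qed.

HB.instance Definition _ (f : clm) :=
  GRing.isLinear.Build R E F _ f (@clm_linear f).

Lemma clm_continuous (f : clm) : continuous f.
Proof. by case: f => f /=; rewrite inE => -[]. Qed.


Definition opnorm (f : clm) : R := sup [set `|f x| | x in [set x : E | `|x| <= 1]].

Lemma opnorm_has_sup (f : clm) :
  has_sup [set `|f x| | x in [set x : E | `|x| <= 1]].
Proof.
split; first by exists `|f 0|; exists 0 => //=; rewrite normr0.
have /linear_boundedP/pinfty_ex_gt0[M M0 fM] :=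
  continuous_linear_bounded 0 (@clm_continuous f 0).
exists M => _ [x /= x1 <-]; rewrite (le_trans (fM x))//.
by rewrite ler_piMr// ltW.
Qed.

Lemma opnorm_ub (f : clm) x : `|x| <= 1 -> `|f x| <= opnorm f.
Proof. by move=> x1; apply: sup_upper_bound; [exact: opnorm_has_sup|exists x]. Qed.

Lemma opnorm_le (f : clm) M :
  (forall x, `|x| <= 1 -> `|f x| <= M) -> opnorm f <= M.
Proof.
move=> fM; apply: ge_sup; first exact: (opnorm_has_sup f).1.
by move=> _ [x /= x1 <-]; exact: fM.
Qed.

Lemma ler_opnormD f g : opnorm (f + g) <= opnorm f + opnorm g.
Proof.
apply: opnorm_le => x x1; rewrite (le_trans (ler_normD _ _))//.
by rewrite lerD// opnorm_ub.
Qed.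

Lemma opnormZ_le (a : R) f : opnorm (a *: f) <= `|a| * opnorm f.
Proof.
by apply: opnorm_le => x x1; rewrite normrZ ler_wpM2l// opnorm_ub.
Qed.

Lemma opnorm_ge0 f : 0 <= opnorm f.
Proof. by apply: (@le_trans _ _ `|f 0|); rewrite // opnorm_ub// normr0. Qed.

Lemma opnormZ (a : R) f : opnorm (a *: f) = `|a| * opnorm f.
Proof.
apply/eqP; rewrite eq_le opnormZ_le /=; have [->|a0] := eqVneq a 0.
  by rewrite normr0 mul0r opnorm_ge0.
have := opnormZ_le a^-1 (a *: f).
by rewrite scalerA mulVf// scale1r normfV ler_pdivlMl ?normr_gt0.
Qed.

Lemma opnorm_eq0 f : opnorm f = 0 -> f = 0.
Proof.
move=> f0; apply: val_inj; apply/funext => x /=.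
have [->|x0] := eqVneq x 0; first exact: (linear0 f).
have : `|f (`|x|^-1 *: x)| <= 0.
  by rewrite -f0 opnorm_ub// normrZ normfV normr_id mulVf ?normr_eq0.
rewrite linearZ /= normrZ normfV normr_id pmulr_rle0 ?invr_gt0 ?normr_gt0//.
by rewrite normr_le0 => /eqP.
Qed.

HB.instance Definition _ :=
  Lmodule_isNormed.Build R clm ler_opnormD opnormZ opnorm_eq0.

(* The zero map when [f] is not linear and continuous. *)
Definition clm_of (f : E -> F) : clm :=
  match pselect (f \in clm_pred) with
  | left fP => Clm fP
  | right _ => 0
  end.

Lemma clm_ofE (f : E -> F) : linear f -> continuous f -> clm_of f = f :> (E -> F).
Proof.
move=> lf cf; rewrite /clm_of; case: pselect => // -[].
by rewrite inE.
Qed.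
End ContinuousLinearMaps.

Arguments clm {R} E F.
Arguments clm_pred {R} E F.

Notation "''L' ( E , F )" := (clm E F) (format "''L' ( E ,  F )").

(* The topological dual with the operator norm. *)
Notation dual E := (clm E (Real.sort _)).

Section Calculus.
Context {R : realType}.
Implicit Types E F H : normedModType R.

Definition reflexive_space E :=
  forall Phi : dual (dual E), exists x : E, forall mu : dual E, Phi mu = mu x.

Definition clm_comp E F H (f : 'L(F, H)) (h : 'L(E, F)) : 'L(E, H) :=
  clm_of (f \o h).

(* The Frechet derivative as a bounded operator. *)
Definition frechet E F (f : E -> F) (x : E) : 'L(E, F) := clm_of ('d f x).

(* [f] is of class C^k on the open set [U], in the norm topology of the spaces
   of bounded operators. *)
Fixpoint Ck_on (k : nat) E F (U : set E) (f : E -> F) : Prop :=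
  match k with
  | 0 => forall x, U x -> {for x, continuous f}
  | k.+1 => (forall x, U x -> differentiable f x) /\ Ck_on k U (frechet f)
  end.

Definition smooth_on E F (U : set E) (f : E -> F) := forall k, Ck_on k U f.

End Calculus.

(* Only the values of [to_model] on [dom] and those of [of_model] on
   [to_model @` dom] are meaningful. *)
Record chart (R : realType) (M : topologicalType) (E : normedModType R) :=
  Chart { dom : set M ; to_model : M -> E ; of_model : E -> M }.

(* A preferred chart around each point; the atlas is the family of all of them.
   The tangent space at [x] is the model space [E], a tangent vector being
   represented by its components in [chart_at x]. *)
Record charted (R : realType) (E : normedModType R) := Charted {
  carrier :> topologicalType ;
  chart_at : carrier -> chart carrier E }.

Section Manifolds.
Context {R : realType}.
Implicit Types E F : normedModType R.

Definition is_chart E (M : topologicalType) (c : chart M E) :=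
  [/\ open (dom c), open (to_model c @` dom c),
      forall x, dom c x -> of_model c (to_model c x) = x,
      forall x, dom c x -> {for x, continuous (to_model c)} &
      forall y, (to_model c @` dom c) y -> {for y, continuous (of_model c)}].

Definition smooth_transition E (M : topologicalType) (c d : chart M E) :=
  smooth_on (to_model c @` (dom c `&` dom d)) (to_model d \o of_model c).

Definition is_manifold E (M : charted E) :=
  [/\ hausdorff_space M,
      forall x : M, is_chart (chart_at x) /\ dom (chart_at x) x &
      forall x y : M, smooth_transition (chart_at x) (chart_at y)].

Definition vs_charted E : charted E :=
  @Charted R E E (fun _ => Chart setT id id).

Definition prod_chart E F (M N : topologicalType) (c : chart M E)
    (d : chart N F) : chart (M * N)%type (E * F)%type :=
  Chart (dom c `*` dom d)
    (fun x => (to_model c x.1, to_model d x.2))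
    (fun y => (of_model c y.1, of_model d y.2)).

Definition prod_charted E F (M : charted E) (N : charted F) :
    charted (E * F)%type :=
  @Charted R (E * F)%type (M * N)%type
    (fun x => prod_chart (chart_at x.1) (chart_at x.2)).

Definition smooth_map E F (M : charted E) (N : charted F) (f : M -> N) :=
  continuous f /\
  forall (x : M) (y : N),
    smooth_on (to_model (chart_at x) @`
                 (dom (chart_at x) `&` f @^-1` dom (chart_at y)))
              (to_model (chart_at y) \o f \o of_model (chart_at x)).

Definition local_rep E F (M : charted E) (N : charted F) (f : M -> N) (x : M)
    : E -> F :=
  to_model (chart_at (f x)) \o f \o of_model (chart_at x).

Definition mdifferentiable E F (M : charted E) (N : charted F) (f : M -> N)
    (x : M) :=
  {for x, continuous f} /\
  differentiable (local_rep f x) (to_model (chart_at x) x).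

(* The tangent map T_x f : T_x M -> T_(f x) N. *)
Definition tmap E F (M : charted E) (N : charted F) (f : M -> N) (x : M)
    : 'L(E, F) :=
  frechet (local_rep f x) (to_model (chart_at x) x).

Definition velocity F (N : charted F) (c : R -> N) (t : R) : F :=
  tmap (c : vs_charted R -> N) t 1.

Definition pullback E F (M : charted E) (N : charted F) (f : M -> N)
    (theta : N -> F -> R) (p : M) (v : E) : R := theta (f p) (tmap f p v).

Section Fields.
Context E (M : charted E).

(* A vector field in the coordinates of [chart_at p]. *)
Definition field_rep (p : M) (X : M -> E) (y : E) : E :=
  let z := of_model (chart_at p) y in
  tmap (to_model (chart_at p) : M -> vs_charted E) z (X z).

Definition jacobi_lie (X Y : M -> E) (p : M) : E :=
  let y := to_model (chart_at p) p in
  frechet (field_rep p Y) y (field_rep p X y)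
  - frechet (field_rep p X) y (field_rep p Y y).

Definition differential (f : M -> R) (p : M) (v : E) : R :=
  tmap (f : M -> vs_charted R) p v.

(* d theta (v, w) for a one-form theta, computed at [p] in the coordinates of
   [chart_at p], without the factor 1/2. *)
Definition ext_deriv (theta : M -> E -> R) (p : M) (v w : E) : R :=
  let y := to_model (chart_at p) p in
  let theta' := pullback (of_model (chart_at p) : vs_charted E -> M) theta in
  'D_v (theta' ^~ w) y - 'D_w (theta' ^~ v) y.

End Fields.

Section Submanifolds.
Context E (M : charted E).

(* A split submanifold: around each of its points some chart of the maximal
   atlas carries [S] to a closed complemented subspace, the kernel of a bounded
   projector [q]. *)
Definition is_submanifold (S : set M) :=
  forall p, S p -> exists (c : chart M E) (q : 'L(E, E)),
    [/\ is_chart c, dom c p,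
        forall x : M, smooth_transition c (chart_at x) /\
                      smooth_transition (chart_at x) c,
        forall v, q (q v) = q v &
        to_model c @` (dom c `&` S) =
          to_model c @` dom c `&` [set v | q v = 0]].

Definition tangent_to (S : set M) (p : M) : set E :=
  [set v | exists c : R -> M,
    [/\ c 0 = p, \forall t \near (0 : R), S (c t),
        mdifferentiable (c : vs_charted R -> M) 0 & velocity c 0 = v]].

Definition symplectic_orthogonal (omega : E -> E -> R) (V : set E) : set E :=
  [set v | forall w, V w -> omega v w = 0].

(* T_p S is its own symplectic orthogonal at each point of S. *)
Definition is_lagrangian (omega : M -> E -> E -> R) (S : set M) :=
  is_submanifold S /\
  forall p, S p ->
    tangent_to S p = symplectic_orthogonal (omega p) (tangent_to S p).

End Submanifolds.
End Manifolds.

(* A Lie group modelled on [E], a Banach space in the intended use. The Lie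
   algebra is T_e G, identified with [E] through the chart at the identity; its
   bracket is [lie_bracket] below. *)
Record lie_group (R : realType) (E : normedModType R) := LieGroup {
  lie_charted :> charted E ;
  lmul : lie_charted -> lie_charted -> lie_charted ;
  lone : lie_charted ;
  linv : lie_charted -> lie_charted ;
  lie_manifold : is_manifold lie_charted ;
  lmulA : associative lmul ;
  lmul1 : left_id lone lmul ;
  lmulV : left_inverse lone linv lmul ;
  lmul_smooth : smooth_map (M := prod_charted lie_charted lie_charted)
    (fun x => lmul x.1 x.2) ;
  linv_smooth : smooth_map linv }.

Arguments lone {R E}.

Section LieGroups.
Context {R : realType} {E : normedModType R} (G : lie_group E).
Implicit Types (g : G) (xi eta : E) (mu nu : dual E).

Definition rmul g : G -> G := fun h => lmul h g.

(* T_e R_g *)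
Definition Tr g : 'L(E, E) := tmap (rmul g) (lone G).

(* T_g R_(g^-1) *)
Definition Trinv g : 'L(E, E) := tmap (rmul (linv g)) g.

(* T_e^* R_g *)
Definition Tr_dual g (alpha : dual E) : dual E := clm_comp alpha (Tr g).

Definition right_invariant xi : G -> E := fun g => Tr g xi.

(* The bracket of right invariant fields, the opposite of the more common one
   of left invariant fields. *)
Definition lie_bracket xi eta : E :=
  jacobi_lie (right_invariant xi) (right_invariant eta) (lone G).

(* [eta |-> mu (lie_bracket xi eta)] is linear and continuous by smoothness of
   the multiplication, so [clm_of] does not fall back on its default value. *)
Definition ad_star xi mu : dual E :=
  clm_of (fun eta => mu (lie_bracket xi eta)).

Definition GxE : charted (E * E)%type := prod_charted G (vs_charted E).

Definition GxE_dual : charted (E * dual E)%type :=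
  prod_charted G (vs_charted (dual E)).

(* The points are ((g, mu), (xi, nu)). *)
Definition tulczyjew : charted ((E * dual E) * (E * dual E))%type :=
  prod_charted GxE_dual (prod_charted (vs_charted E) (vs_charted (dual E))).

Definition trivialization (x : GxE_dual) (V : E * dual E) : tulczyjew :=
  let xi := Trinv x.1 V.1 in (x, (xi, V.2 - ad_star xi x.2)).

Definition tulczyjew_proj (p : tulczyjew) : GxE := (p.1.1, p.2.1).

(* The vector X_(xi2, nu2, xi3, nu3) at p, with c = ((xi2, nu2), (xi3, nu3)). *)
Definition tulczyjew_vector (p : tulczyjew) (c : (E * dual E) * (E * dual E)) :
    (E * dual E) * (E * dual E) :=
  let: ((g, mu), (xi, nu)) := p in
  let: ((xi2, nu2), (xi3, nu3)) := c in
  ((Tr g xi2, nu2 + ad_star xi2 mu),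
   (xi3 + lie_bracket xi xi2, nu3 + ad_star xi2 nu - ad_star xi nu2)).

(* [tulczyjew_vector p] being a bijection, [c] is the unique solution. *)
Definition theta2 (p : tulczyjew) (V : (E * dual E) * (E * dual E)) : R :=
  let: ((g, mu), (xi, nu)) := p in
  let c := xget 0 [set c | tulczyjew_vector p c = V] in
  let: ((xi2, nu2), (xi3, nu3)) := c in
  mu xi3 + nu xi2 + mu (lie_bracket xi xi2).

Definition Omega := ext_deriv theta2.

Section Lagrangian.
Variable L : GxE -> R.

Definition dL_dg g xi : dual E :=
  tmap ((fun h => L (h, xi)) : G -> vs_charted R) g.

Definition dL_dxi g xi : dual E := frechet (fun eta => L (g, eta)) xi.

Definition lagrangian_set : set tulczyjew :=
  [set p | pullback tulczyjew_proj (differential L) p = theta2 p].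

End Lagrangian.
End LieGroups.

(* Main.v *)
Require Import Defs.
From HB Require Import structures.
From mathcomp Require Import all_boot all_order all_algebra.
From mathcomp Require Import all_classical all_reals.
From mathcomp Require Import topology normedtype landau derive.
From mathcomp Require Import ring.

Set Implicit Arguments.
Unset Strict Implicit.
Unset Printing Implicit Defensive.

Import Order.TTheory GRing.Theory Num.Theory numFieldNormedType.Exports.

Local Open Scope classical_set_scope.
Local Open Scope ring_scope.

(** Right invariance makes the bracket disappear from the one-form. In a tangent
vector X_(xi_2, nu_2, xi_3, nu_3) = (V_g, V_mu, V_xi, V_nu) the terms xi_3 and
[xi, xi_2] only occur through V_xi = xi_3 + [xi, xi_2], so that

   theta_2 (V) = mu (V_xi) + nu (T R_(g^-1) V_g)

([theta2E]). Comparing with dL, and because T R_(g^-1) is onto, S is the graph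

   mu = A (g, xi) := dL/dxi,   nu = B (g, xi) := T_e^* R_g (dL/dg)

over the configuration space G x E ([lagrangian_setP]). The trivialized velocity
has nu = (dmu/dt) - ad^*_xi mu, so the second equation is the Euler-Lagrange
equation as soon as the first one holds on an open set of times
([lagrangian_set_velocity]).

That S is Lagrangian is checked in the preferred chart phi at a point g0 of G,
with coordinates ((u, m), (x, n)). There the one-form is m dx + n P(u) du, where
P is the right Maurer-Cartan form, hence

   Omega (v, w) = v_m (w_x) + v_n (P w_u) + n (DP (v_u) w_u) - (v <-> w)

([OmegaE]). For the local Lagrangian l (u, x) = L (phi^-1 u, x) one has
A = d_2 l and B (u, x) o P (u) = d_1 l.

- Submanifold: A and B are smooth since L and the multiplication are, and the
  shear ((u, m), (x, n)) |-> ((u, m - A), (x, n - B)) straightens S to the kernel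
  of a projector. The tangent space of S is the graph of the derivative of
  (A, B) ([chart_graph_straighten], [chart_graph_tangent]).

- Isotropy: on two tangent vectors of S, Omega is the antisymmetrization of the
  second derivative of l, which is symmetric ([lagrangian_tangent_isotropic],
  [second_derivative_sym]).

- Maximality: if v is orthogonal to the tangent space, subtract from v the tangent
  vector with the same (u, x)-components. The remainder (0, a, 0, b) satisfies
  a (w_x) + b (P w_u) = 0 for all w_x and w_u, and P is onto, so it vanishes
  ([lagrangian_tangent_maximal]).

The calculus behind the word smooth is the stability of maps of class C^k, for
derivatives taken in spaces of bounded operators, under bounded bilinear maps
and composition ([Ck_on_bilin], [Ck_on_comp]). *)

(** * Bounded operators *)

Section BoundedOperators.
Context {R : realType}.
Implicit Types E F H : normedModType R.

Lemma clm_eqP E F (f g : 'L(E, F)) : f =1 g -> f = g.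
Proof. by move=> fg; apply: val_inj; apply/funext. Qed.

Lemma clm_addE E F (f g : 'L(E, F)) x : (f + g) x = f x + g x.
Proof. by []. Qed.

Lemma clm_subE E F (f g : 'L(E, F)) x : (f - g) x = f x - g x.
Proof. by []. Qed.

Lemma clm_scaleE E F (a : R) (f : 'L(E, F)) x : (a *: f) x = a *: f x.
Proof. by []. Qed.

Lemma clm0 E F (f : 'L(E, F)) : f 0 = 0.
Proof. exact: linear0. Qed.

Lemma clm_norm_le E F (f : 'L(E, F)) x : `|f x| <= `|f| * `|x|.
Proof.
have [->|x0] := eqVneq x 0; first by rewrite linear0 !normr0 mulr0.
have nx : 0 < `|x| by rewrite normr_gt0.
rewrite -ler_pdivrMr// mulrC -[X in X * _]ger0_norm ?invr_ge0//.
rewrite -normrZ -linearZ; apply: opnorm_ub.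
by rewrite normrZ ger0_norm ?invr_ge0// mulVf// gt_eqF.
Qed.

Lemma clm_norm_ub E F (f : 'L(E, F)) (M : R) : 0 <= M ->
  (forall x, `|f x| <= M * `|x|) -> `|f| <= M.
Proof.
move=> M0 fM; apply: opnorm_le => x x1; rewrite (le_trans (fM x))//.
by rewrite ler_piMr.
Qed.

(** A bound is what one has at hand for a concrete map; it spares the continuity
proof that [clm_ofE] asks for. *)
Lemma bounded_clm_of E F (f : E -> F) (M : R) : linear f ->
  (forall x, `|f x| <= M * `|x|) -> clm_of f = f :> (E -> F).
Proof.
move=> lf fM; apply: clm_ofE => //.
pose f' : {linear E -> F} := HB.pack f (GRing.isLinear.Build R E F _ f lf).
suff : continuous f' by [].
apply: bounded_linear_continuous; apply/linear_boundedP.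
exists (Num.max M 0); split; first exact: num_real.
move=> r Mr x; rewrite (le_trans (fM x))// ler_wpM2r//.
by move: Mr; rewrite gt_max => /andP[/ltW].
Qed.

Lemma clm_compE E F H (f : 'L(F, H)) (h : 'L(E, F)) x :
  clm_comp f h x = f (h x).
Proof.
rewrite /clm_comp (@bounded_clm_of _ _ _ (`|f| * `|h|))//.
  by move=> a u v /=; rewrite !linearP.
move=> u /=; rewrite (le_trans (clm_norm_le _ _))// -mulrA ler_wpM2l//.
exact: clm_norm_le.
Qed.

Lemma clm_of_clm E F (f : 'L(E, F)) : clm_of f = f.
Proof.
by apply: clm_eqP => x; rewrite clm_ofE//; [exact: clm_linear|exact: clm_continuous].
Qed.

Definition inl_clm E F : 'L(E, (E * F)%type) := clm_of (fun x => (x, 0)).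
Definition inr_clm E F : 'L(F, (E * F)%type) := clm_of (fun y => (0, y)).
Definition fst_clm E F : 'L((E * F)%type, E) := clm_of fst.
Definition snd_clm E F : 'L((E * F)%type, F) := clm_of snd.
Definition id_clm E : 'L(E, E) := clm_of id.

Lemma inl_clmE E F x : inl_clm E F x = (x, 0).
Proof.
rewrite /inl_clm (@bounded_clm_of _ _ _ 1)//.
  by move=> a u v; rewrite -[RHS]/(a *: u + v, a *: 0 + 0) scaler0 addr0.
by move=> u; rewrite mul1r prod_normE /= normr0 ge_max lexx normr_ge0.
Qed.

Lemma inr_clmE E F x : inr_clm E F x = (0, x).
Proof.
rewrite /inr_clm (@bounded_clm_of _ _ _ 1)//.
  by move=> a u v; rewrite -[RHS]/(a *: 0 + 0, a *: u + v) scaler0 addr0.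
by move=> u; rewrite mul1r prod_normE /= normr0 ge_max lexx normr_ge0.
Qed.

Lemma fst_clmE E F x : fst_clm E F x = x.1.
Proof.
rewrite /fst_clm (@bounded_clm_of _ _ _ 1)//.
by move=> u; rewrite mul1r prod_normE le_max lexx.
Qed.

Lemma snd_clmE E F x : snd_clm E F x = x.2.
Proof.
rewrite /snd_clm (@bounded_clm_of _ _ _ 1)//.
by move=> u; rewrite mul1r prod_normE le_max lexx orbT.
Qed.

Lemma id_clmE E x : id_clm E x = x.
Proof.
by rewrite /id_clm (@bounded_clm_of _ _ _ 1)// => u; rewrite mul1r.
Qed.

(** Both the equations of S and the maximality of its tangent space come from
testing a pair of covectors against independent b and T a. *)
Lemma dual_pair_inj E (m n m' n' : dual E) (T : 'L(E, E)) (T' : E -> E) :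
  (forall x, T (T' x) = x) ->
  (forall a b, m b + n (T a) = m' b + n' (T a)) -> m = m' /\ n = n'.
Proof.
move=> TK H; split; apply: clm_eqP => x.
  by have := H 0 x; rewrite !clm0 !addr0.
by have := H (T' x) 0; rewrite !clm0 !add0r TK.
Qed.

Definition bounded_bilinear E F H (B : E -> F -> H) :=
  [/\ forall y, linear (B^~ y), forall x, linear (B x) &
      exists2 M, 0 <= M & forall x y, `|B x y| <= M * `|x| * `|y|].

Lemma clm_of_bilinear1 E F H (B : E -> F -> H) y : bounded_bilinear B ->
  clm_of (B^~ y) = B^~ y :> (E -> H).
Proof.
move=> [Bl _ [M M0 BM]]; rewrite (@bounded_clm_of _ _ _ (M * `|y|))// => x.
by rewrite mulrAC.
Qed.

Lemma clm_of_bilinear2 E F H (B : E -> F -> H) x : bounded_bilinear B ->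
  clm_of (B x) = B x :> (F -> H).
Proof.
by move=> [_ Br [M M0 BM]]; rewrite (@bounded_clm_of _ _ _ (M * `|x|)).
Qed.

Lemma bounded_bilinear_comp E F H :
  bounded_bilinear (fun (f : 'L(F, H)) (h : 'L(E, F)) => clm_comp f h).
Proof.
split=> [h a f f'|f a h h'|].
- by apply: clm_eqP => x; rewrite clm_addE clm_scaleE !clm_compE.
- by apply: clm_eqP => x; rewrite clm_addE clm_scaleE !clm_compE linearP.
- exists 1 => // f h; rewrite mul1r; apply: clm_norm_ub => [|x].
    by rewrite mulr_ge0.
  rewrite clm_compE (le_trans (clm_norm_le _ _))// -mulrA ler_wpM2l//.
  exact: clm_norm_le.
Qed.

Lemma bounded_bilinear_eval E F :
  bounded_bilinear (fun (f : 'L(E, F)) (x : E) => f x).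
Proof.
split=> [//|f|]; first exact: clm_linear.
by exists 1 => // f x; rewrite mul1r clm_norm_le.
Qed.

(** The two halves of the Leibniz rule for x |-> B (f x) (g x), as operations on
derivatives: for A and C the derivatives of f and g, it is bilin_l B A (g x) +
bilin_r B (f x) C. *)
Definition bilin_l E' E F H (B : E -> F -> H) (A : 'L(E', E)) (y : F) :
  'L(E', H) := clm_comp (clm_of (B^~ y)) A.
Definition bilin_r E' E F H (B : E -> F -> H) (x : E) (C : 'L(E', F)) :
  'L(E', H) := clm_comp (clm_of (B x)) C.

Lemma bilin_lE E' E F H (B : E -> F -> H) (A : 'L(E', E)) (y : F) v :
  bounded_bilinear B -> bilin_l B A y v = B (A v) y.
Proof. by move=> bB; rewrite clm_compE clm_of_bilinear1. Qed.

Lemma bilin_rE E' E F H (B : E -> F -> H) (x : E) (C : 'L(E', F)) v :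
  bounded_bilinear B -> bilin_r B x C v = B x (C v).
Proof. by move=> bB; rewrite clm_compE clm_of_bilinear2. Qed.

(** The two halves of the Leibniz rule are themselves bounded bilinear, which is
what lets [Ck_on_bilin] be proved by induction on k. *)
Lemma bounded_bilinear_l E' E F H (B : E -> F -> H) :
  bounded_bilinear B -> bounded_bilinear (@bilin_l E' E F H B).
Proof.
move=> bB; have [Bl Br [M M0 BM]] := bB; split=> [y a f g|A a y z|].
- by apply: clm_eqP => v; rewrite clm_addE clm_scaleE !bilin_lE// Bl.
- by apply: clm_eqP => v; rewrite clm_addE clm_scaleE !bilin_lE// Br.
- exists M => // A y; apply: clm_norm_ub => [|v]; first by rewrite !mulr_ge0.
  rewrite bilin_lE// (le_trans (BM _ _))// [leRHS]mulrAC ler_wpM2r//.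
  by rewrite -mulrA ler_wpM2l// clm_norm_le.
Qed.

Lemma bounded_bilinear_r E' E F H (B : E -> F -> H) :
  bounded_bilinear B -> bounded_bilinear (@bilin_r E' E F H B).
Proof.
move=> bB; have [Bl Br [M M0 BM]] := bB; split=> [C a f g|x a y z|].
- by apply: clm_eqP => v; rewrite clm_addE clm_scaleE !bilin_rE// Bl.
- by apply: clm_eqP => v; rewrite clm_addE clm_scaleE !bilin_rE// Br.
- exists M => // x C; apply: clm_norm_ub => [|v]; first by rewrite !mulr_ge0.
  rewrite bilin_rE// (le_trans (BM _ _))// -[leRHS]mulrA ler_wpM2l ?mulr_ge0//.
  exact: clm_norm_le.
Qed.

End BoundedOperators.

(** * Frechet derivatives *)

Section Derivatives.
Context {R : realType}.
Implicit Types E F H : normedModType R.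

Lemma is_diffP E F (f : E -> F) x (A : 'L(E, F)) :
  is_diff x f A <->
  forall e, 0 < e -> \forall h \near (0 : E), `|f (h + x) - f x - A h| <= e * `|h|.
Proof.
have key : f \o shift x = cst (f x) + (A : E -> F) +o_ (0 : E) id <->
  forall e, 0 < e -> \forall h \near (0 : E), `|f (h + x) - f x - A h| <= e * `|h|.
  split=> [/eqaddoP H e /H|H].
    by apply: filterS => h /=; rewrite opprD addrA.
  by apply/eqaddoP => e /H; apply: filterS => h /=; rewrite opprD addrA.
split=> [[df fA]|/(proj2 key) H].
  by apply/key; rewrite -fA; have /diff_locallyP[] := df.
have cA : continuous A := @clm_continuous _ _ _ A.
have fA : 'd f x = A :> (E -> F) by apply: diff_unique.
by split=> //; apply/diff_locallyP; rewrite fA.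
Qed.

Lemma is_diff_frechet E F (f : E -> F) x (A : 'L(E, F)) :
  is_diff x f A -> frechet f x = A.
Proof. by move=> [_ fA]; rewrite /frechet fA clm_of_clm. Qed.

Lemma frechetP E F (f : E -> F) x :
  differentiable f x -> is_diff x f (frechet f x).
Proof.
move=> df; split=> //; rewrite /frechet clm_ofE//; last exact: diff_continuous.
exact: linearP.
Qed.

Lemma is_diff_frechetE E F (f : E -> F) x (A : E -> F) :
  is_diff x f A -> frechet f x = A :> (E -> F).
Proof. by move=> [df <-]; have [_ ->] := frechetP df. Qed.

Lemma is_diff_near E F (f g : E -> F) x (A : E -> F) :
  (\forall y \near x, f y = g y) -> is_diff x f A -> is_diff x g A.
Proof.
move=> fg dfA; have [df <-] := dfA.
have [_ ->] := frechetP df; have := frechetP df.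
move=> /is_diffP H; apply/is_diffP => e /H He.
have fg0 : \forall h \near (0 : E), f (h + x) = g (h + x).
  have : \forall h \near (0 : E), (fun y => f y = g y) (h + x).
    by have := fg; rewrite (near_shift 0 x) subr0.
  by [].
rewrite -(nbhs_singleton fg); near=> h.
have -> : g (h + x) = f (h + x) by apply/esym; near: h.
by near: h.
Unshelve. all: by end_near. Qed.

Lemma frechet_near E F (f g : E -> F) x :
  (\forall y \near x, f y = g y) -> differentiable f x ->
  frechet f x = frechet g x.
Proof.
by move=> fg /frechetP H; apply/esym/is_diff_frechet; exact: is_diff_near H.
Qed.

Lemma differentiable_near E F (f g : E -> F) x :
  (\forall y \near x, f y = g y) -> differentiable f x -> differentiable g x.
Proof. by move=> fg /frechetP /(is_diff_near fg)[]. Qed.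

Lemma is_diff_clm E F (A : 'L(E, F)) x : is_diff x A A.
Proof.
apply/is_diffP => e e0; near=> h.
by rewrite linearD addrK subrr normr0 mulr_ge0// ltW.
Unshelve. all: by end_near. Qed.

Lemma is_diff_fst E F (x : E * F) : is_diff x fst fst.
Proof.
have -> : @fst E F = fst_clm E F by apply/funext => z; rewrite fst_clmE.
exact: is_diff_clm.
Qed.

Lemma is_diff_snd E F (x : E * F) : is_diff x snd snd.
Proof.
have -> : @snd E F = snd_clm E F by apply/funext => z; rewrite snd_clmE.
exact: is_diff_clm.
Qed.

(** With p = (f x, g x), the remainder of B at p is B h.1 h.2, at most
M |h|^2, hence negligible. *)
Lemma is_diff_bilin E F H E' (B : F -> H -> E') (f : E -> F) (g : E -> H) x
    (A : E -> F) (C : E -> H) : bounded_bilinear B ->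
  is_diff x f A -> is_diff x g C ->
  is_diff x (fun z => B (f z) (g z)) (fun v => B (A v) (g x) + B (f x) (C v)).
Proof.
move=> bB dfA dgC; have [Bl Br [M M0 BM]] := bB.
have BDl y u v : B (u + v) y = B u y + B v y.
  by have := Bl y 1 u v; rewrite !scale1r.
have BDr y u v : B y (u + v) = B y u + B y v.
  by have := Br y 1 u v; rewrite !scale1r.
pose p := (f x, g x).
pose D : 'L((F * H)%type, E') :=
  clm_comp (clm_of (B^~ p.2)) (fst_clm F H) + clm_comp (clm_of (B p.1)) (snd_clm F H).
have DE v : D v = B v.1 p.2 + B p.1 v.2.
  by rewrite clm_addE !clm_compE fst_clmE snd_clmE clm_of_bilinear1// clm_of_bilinear2.
have dB : is_diff p (fun z => B z.1 z.2) D.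
  apply/is_diffP => e e0.
  have eM : 0 < e / (M + 1) by rewrite divr_gt0// ltr_wpDl.
  near=> h.
  have hM : `|h| <= e / (M + 1).
    by near: h; apply: filterS (nbhs0_lt eM) => h; exact: ltW.
  have -> : B (h + p).1 (h + p).2 - B p.1 p.2 - D h = B h.1 h.2.
    by rewrite DE /= BDl !BDr addrA addrK -(addrA (B h.1 h.2)) addrK.
  rewrite (le_trans (BM _ _))//.
  have h1 : `|h.1| <= `|h| by rewrite prod_normE le_max lexx.
  have h2 : `|h.2| <= `|h| by rewrite prod_normE le_max lexx orbT.
  rewrite ler_pM ?mulr_ge0//.
  rewrite (@le_trans _ _ ((M + 1) * `|h|))// ?ler_pM ?lerDl//.
  by rewrite mulrC -ler_pdivlMr ?ltr_wpDl.
have dp : is_diff x (fun z => (f z, g z)) (fun v => (A v, C v)) by exact: is_diff_pair.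
have := @is_diff_comp _ _ _ _ _ _ _ _ _ dp dB.
suff -> : (D : _ -> _) \o (fun v => (A v, C v)) = (fun v => B (A v) (g x) + B (f x) (C v)) by [].
by apply/funext => v; rewrite -[LHS]/(D (A v, C v)) DE.
Unshelve. all: by end_near. Qed.

Lemma is_diff_prod E F E' F' (f : E -> F) (g : E' -> F') x y A C :
  is_diff x f A -> is_diff y g C ->
  is_diff (x, y) (fun z => (f z.1, g z.2)) (fun v => (A v.1, C v.2)).
Proof.
move=> dfA dgC; apply: is_diff_pair.
  exact: (@is_diff_comp _ _ _ _ _ _ _ _ _ (is_diff_fst (x, y)) dfA).
exact: (@is_diff_comp _ _ _ _ _ _ _ _ _ (is_diff_snd (x, y)) dgC).
Qed.

Lemma frechet_comp E F H (f : F -> H) (h : E -> F) x :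
  differentiable h x -> differentiable f (h x) ->
  frechet (f \o h) x = clm_comp (frechet f (h x)) (frechet h x).
Proof.
move=> /frechetP dh /frechetP df; apply: is_diff_frechet.
suff -> : (clm_comp (frechet f (h x)) (frechet h x) : _ -> _) =
  frechet f (h x) \o frechet h x by exact: is_diff_comp.
by apply/funext => v; rewrite clm_compE.
Qed.

Lemma frechet_clm E F (A : 'L(E, F)) x : frechet A x = A.
Proof. exact/is_diff_frechet/is_diff_clm. Qed.

Lemma frechet_id E (x : E) : frechet id x = id_clm E.
Proof.
rewrite -[RHS](frechet_clm _ x); congr frechet.
by apply/funext => y; rewrite id_clmE.
Qed.

Lemma frechet_cst E F (c : F) (x : E) : frechet (fun=> c) x = 0.
Proof. exact: is_diff_frechet. Qed.

Lemma frechet_partial1 E F H (f : E * F -> H) x y : differentiable f (x, y) ->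
  frechet (fun x => f (x, y)) x = clm_comp (frechet f (x, y)) (inl_clm E F).
Proof.
move=> /frechetP df; apply: is_diff_frechet.
have dp : is_diff x (fun z => (z, y)) (fun v => (v, 0)).
  by apply: is_diff_pair; exact: is_diff_cst.
have := @is_diff_comp _ _ _ _ _ _ _ _ _ dp df.
suff -> : (clm_comp (frechet f (x, y)) (inl_clm E F) : _ -> _) =
  frechet f (x, y) \o (fun v => (v, 0)) by [].
by apply/funext => v; rewrite clm_compE inl_clmE.
Qed.

Lemma frechet_partial2 E F H (f : E * F -> H) x y : differentiable f (x, y) ->
  frechet (fun y => f (x, y)) y = clm_comp (frechet f (x, y)) (inr_clm E F).
Proof.
move=> /frechetP df; apply: is_diff_frechet.
have dp : is_diff y (fun z => (x, z)) (fun v => (0, v)).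
  by apply: is_diff_pair; exact: is_diff_cst.
have := @is_diff_comp _ _ _ _ _ _ _ _ _ dp df.
suff -> : (clm_comp (frechet f (x, y)) (inr_clm E F) : _ -> _) =
  frechet f (x, y) \o (fun v => (0, v)) by [].
by apply/funext => v; rewrite clm_compE inr_clmE.
Qed.

Lemma differentiable_partial1 E F H (f : E * F -> H) x y :
  differentiable f (x, y) -> differentiable (fun x => f (x, y)) x.
Proof.
move=> df; apply: (@differentiable_comp _ _ _ _ (fun x => (x, y)) f) => //.
Qed.

End Derivatives.

(** * Maps of class C^k *)

Section CkCalculus.
Context {R : realType}.
Implicit Types (E F H : normedModType R) (k : nat).

Lemma open_near E (U : set E) x (P : E -> Prop) : open U -> U x ->
  (forall y, U y -> P y) -> \forall y \near x, P y.
Proof. by move=> oU Ux UP; apply: filterS UP _; exact: open_nbhs_nbhs. Qed.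

Lemma Ck_onS k E F (U V : set E) (f : E -> F) :
  U `<=` V -> Ck_on k V f -> Ck_on k U f.
Proof.
elim: k F f => [|k IH] F f UV /=; first by move=> cf x /UV; exact: cf.
by move=> [df Cf]; split; [move=> x /UV; exact: df|exact: IH].
Qed.

Lemma Ck_on_eq k E F (U : set E) (f g : E -> F) : open U ->
  (forall x, U x -> f x = g x) -> Ck_on k U f -> Ck_on k U g.
Proof.
move=> oU; elim: k F f g => [|k IH] F f g fg /=.
  move=> cf x Ux; rewrite /prop_for /continuous_at -fg//.
  apply: cvg_trans (cf x Ux); apply: near_eq_cvg.
  by apply: open_near fg.
have nfg x : U x -> \forall y \near x, f y = g y by move=> Ux; exact: open_near fg.
move=> [df Cf]; split=> [x Ux|].
  by apply: differentiable_near (df x Ux); exact: nfg.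
by apply: IH Cf => x Ux; apply: frechet_near; [exact: nfg|exact: df].
Qed.

Lemma Ck_onW k E F (U : set E) (f : E -> F) : Ck_on k.+1 U f -> Ck_on k U f.
Proof.
elim: k F f => [|k IH] F f.
  by move=> [df _] x /df; exact: differentiable_continuous.
by move=> [df Cf]; split=> //; exact: IH.
Qed.

Lemma Ck_on_cst k E F (U : set E) (c : F) : Ck_on k U (fun=> c).
Proof.
elim: k F c => [|k IH] F c; first by move=> x _; exact: cst_continuous.
split=> [x _|]; first exact: differentiable_cst.
have -> : frechet (fun _ : E => c) = fun=> 0 by apply/funext => x; exact: frechet_cst.
exact: IH.
Qed.

Lemma Ck_on_clm k E F (U : set E) (A : 'L(E, F)) : Ck_on k U A.
Proof.
case: k => [|k]; first by move=> x _; exact: clm_continuous.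
split=> [x _|]; first by have [] := is_diff_clm A x.
have -> : frechet A = fun=> A by apply/funext => x; exact: frechet_clm.
exact: Ck_on_cst.
Qed.

Lemma Ck_on_id k E (U : set E) : Ck_on k U (@id E).
Proof.
have -> : @id E = id_clm E by apply/funext => x; rewrite id_clmE.
exact: Ck_on_clm.
Qed.

Lemma Ck_on_fst k E F (U : set (E * F)) : Ck_on k U (@fst E F).
Proof.
have -> : @fst E F = fst_clm E F by apply/funext => x; rewrite fst_clmE.
exact: Ck_on_clm.
Qed.

Lemma Ck_on_snd k E F (U : set (E * F)) : Ck_on k U (@snd E F).
Proof.
have -> : @snd E F = snd_clm E F by apply/funext => x; rewrite snd_clmE.
exact: Ck_on_clm.
Qed.

Lemma Ck_on_add k E F (U : set E) (f g : E -> F) : open U ->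
  Ck_on k U f -> Ck_on k U g -> Ck_on k U (fun x => f x + g x).
Proof.
move=> oU; elim: k F f g => [|k IH] F f g.
  by move=> cf cg x Ux; apply: continuousD; [exact: cf|exact: cg].
move=> [df Cf] [dg Cg]; split=> [x Ux|].
  by apply: differentiableD; [exact: df|exact: dg].
apply: (Ck_on_eq (f := fun x => frechet f x + frechet g x)) (IH _ _ _ Cf Cg) => //.
move=> x Ux; apply/esym/is_diff_frechet.
by apply: is_diffD; apply: frechetP; [exact: df|exact: dg].
Qed.

(** The derivative of B (f x) (g x) is a sum of two bounded bilinear expressions
in (f', g) and (f, g'), to which the induction hypothesis applies, with other
spaces and another bilinear map. *)
Lemma Ck_on_bilin k E F H E' (B : F -> H -> E') (U : set E)
    (f : E -> F) (g : E -> H) : bounded_bilinear B -> open U ->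
  Ck_on k U f -> Ck_on k U g -> Ck_on k U (fun x => B (f x) (g x)).
Proof.
move=> bB oU; elim: k F H E' B bB f g => [|k IH] F H E' B bB f g.
  move=> cf cg x Ux.
  have dB : differentiable (fun z : F * H => B z.1 z.2) (f x, g x).
    by have [] := is_diff_bilin bB (is_diff_fst (f x, g x)) (is_diff_snd (f x, g x)).
  apply: (@continuous_comp _ _ _ (fun x => (f x, g x)) (fun z => B z.1 z.2)).
    by apply: cvg_pair; [exact: cf|exact: cg].
  exact: differentiable_continuous.
move=> Cf Cg; have [df Df] := Cf; have [dg Dg] := Cg.
have dB x : U x -> is_diff x (fun x => B (f x) (g x))
    (bilin_l B (frechet f x) (g x) + bilin_r B (f x) (frechet g x)).
  move=> Ux.
  apply: (is_diff_eq (is_diff_bilin bB (frechetP (df x Ux)) (frechetP (dg x Ux)))).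
  apply/funext => v.
  by rewrite clm_addE bilin_lE// bilin_rE.
split=> [x /dB[]//|].
apply: (Ck_on_eq (f := fun x =>
  bilin_l B (frechet f x) (g x) + bilin_r B (f x) (frechet g x))) => //.
  by move=> x Ux; apply/esym/is_diff_frechet; exact: dB.
apply: Ck_on_add => //.
  exact: (IH _ _ _ _ (bounded_bilinear_l E bB) _ _ Df (Ck_onW Cg)).
exact: (IH _ _ _ _ (bounded_bilinear_r E bB) _ _ (Ck_onW Cf) Dg).
Qed.

Lemma Ck_on_clm_comp k E F H E' (U : set E') (f : E' -> 'L(F, H))
    (g : E' -> 'L(E, F)) : open U ->
  Ck_on k U f -> Ck_on k U g -> Ck_on k U (fun x => clm_comp (f x) (g x)).
Proof. exact/Ck_on_bilin/bounded_bilinear_comp. Qed.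

Lemma Ck_on_continuous k E F (U : set E) (f : E -> F) : Ck_on k U f ->
  forall x, U x -> {for x, continuous f}.
Proof.
case: k => // k; move=> [df _] x Ux; exact/differentiable_continuous/df.
Qed.

Lemma open_setI_preimage (E F : topologicalType) (U : set E) (V : set F)
    (f : E -> F) : open U -> open V ->
  (forall x, U x -> {for x, continuous f}) -> open (U `&` f @^-1` V).
Proof.
move=> oU oV cf; rewrite openE => x [Ux Vfx].
apply: filterI; first exact: open_nbhs_nbhs.
by apply: (cf x Ux); exact: open_nbhs_nbhs.
Qed.

(** By induction on k: the derivative at x is the composite of f' (g x) and g' x,
and composing operators is bounded bilinear. *)
Lemma Ck_on_comp k E F H (U : set E) (V : set F) (f : F -> H) (g : E -> F) :
  open U -> open V -> Ck_on k V f -> Ck_on k U g ->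
  Ck_on k (U `&` g @^-1` V) (f \o g).
Proof.
move=> oU oV; elim: k H f => [|k IH] H f.
  by move=> cf cg x [Ux Vx]; apply: continuous_comp; [exact: cg|exact: cf].
move=> Cf Cg; have [df Df] := Cf; have [dg Dg] := Cg.
have oW : open (U `&` g @^-1` V).
  by apply: open_setI_preimage => //; exact: Ck_on_continuous Cg.
split=> [x [Ux Vx]|]; first by apply: differentiable_comp; [exact: dg|exact: df].
apply: (Ck_on_eq (f := fun x => clm_comp (frechet f (g x)) (frechet g x))) => //.
  by move=> x [Ux Vx]; rewrite frechet_comp//; [exact: dg|exact: df].
apply: Ck_on_clm_comp => //; first by apply: IH => //; exact: Ck_onW.
by apply: Ck_onS Dg => x [].
Qed.

Lemma Ck_on_pair k E F H (U : set E) (f : E -> F) (g : E -> H) : open U ->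
  Ck_on k U f -> Ck_on k U g -> Ck_on k U (fun x => (f x, g x)).
Proof.
move=> oU Cf Cg.
have CA (F' : normedModType R) (A : 'L(F', (F * H)%type)) (h : E -> F') :
    Ck_on k U h -> Ck_on k U (A \o h).
  move=> Ch; rewrite -[U]setIT -(preimage_setT h).
  by apply: Ck_on_comp Ch => //; [exact: openT|exact: Ck_on_clm].
apply: (Ck_on_eq (f := fun x => inl_clm F H (f x) + inr_clm F H (g x))) => //.
  by move=> x _; rewrite inl_clmE inr_clmE; congr (_, _); rewrite /= ?addr0 ?add0r.
by apply: Ck_on_add => //; [exact: CA (inl_clm F H) f Cf|exact: CA (inr_clm F H) g Cg].
Qed.

(** W is meant to be the image of an overlap of charts, whose openness would take
a separate argument. *)
Lemma smooth_on_comp E F H (W U : set E) (V : set F) (f : F -> H) (g : E -> F) :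
  open U -> open V -> smooth_on V f -> smooth_on U g ->
  W `<=` U -> (forall x, W x -> V (g x)) -> smooth_on W (f \o g).
Proof.
move=> oU oV Cf Cg WU WV k.
apply: (@Ck_onS _ _ _ _ (U `&` g @^-1` V)); last by apply: Ck_on_comp.
by move=> x Wx; split; [exact: WU|exact: WV].
Qed.

Lemma smooth_on_differentiable E F (U : set E) (f : E -> F) :
  smooth_on U f -> forall x, U x -> differentiable f x.
Proof. by move=> /(_ 1)[]. Qed.

Lemma smooth_on_frechet E F (U : set E) (f : E -> F) :
  smooth_on U f -> smooth_on U (frechet f).
Proof. by move=> Cf k; have [] := Cf k.+1. Qed.

End CkCalculus.

(** * Symmetry of the second derivative *)

Section SecondDerivative.
Context {R : realType}.
Implicit Types (E F : normedModType R).

Lemma is_diff_derive E F (f : E -> F) x (A : E -> F) v :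
  is_diff x f A -> is_derive x v f (A v).
Proof.
move=> [df fA]; split; first exact: diff_derivable.
by rewrite deriveE// fA.
Qed.

Definition cross_difference E (f : E -> R) (x a b : E) (t : R) : R :=
  f (t *: a + (t *: b + x)) - f (t *: a + x) - (f (t *: b + x) - f x).

(** The mean value theorem for s |-> f (s a + t b + x) - f (s a + x) on [0, t]
turns the cross difference into t (f' (c a + t b + x) - f' (c a + x)) a, and the
differentiability of f' at x evaluates it up to e t^2. *)
Lemma cross_difference_approx E (f : E -> R) (U : set E) (x : E) :
  open U -> U x -> Ck_on 2 U f -> forall a b e, 0 < e ->
  exists2 r, 0 < r & forall t, 0 < t -> t < r ->
  `|cross_difference f x a b t - t ^+ 2 * frechet (frechet f) x b a| <=
     e * t ^+ 2 * ((`|a| + `|b| + `|a|) * `|a|).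
Proof.
move=> oU Ux [df [dg _]] a b e e0.
have /is_diffP/(_ e e0) Dg := frechetP (dg x Ux).
have Un : \forall h \near (0 : E), U (h + x).
  have : \forall y \near x, U y by exact: open_nbhs_nbhs.
  by rewrite (near_shift 0 x) subr0.
have /nbhs_ballP[r0 /= r00 Hr] : \forall h \near (0 : E), U (h + x) /\
    `|frechet f (h + x) - frechet f x - frechet (frechet f) x h| <= e * `|h|.
  by apply: filterI.
have {Hr}Hr h : `|h| < r0 -> U (h + x) /\
    `|frechet f (h + x) - frechet f x - frechet (frechet f) x h| <= e * `|h|.
  by move=> hr; apply: Hr; rewrite -ball_normE /= sub0r normrN.
set D := frechet (frechet f) x in Hr *.
(* with t K < r0, all points used below stay in the ball of radius r0 at x;
   the summand 1 keeps K positive *)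
set K := `|a| + `|b| + 1.
have K0 : 0 < K by rewrite ltr_wpDl// addr_ge0.
exists (r0 / K); first by rewrite divr_gt0.
move=> t t0; rewrite ltr_pdivlMr// => tr.
have small s : s \in `[0, t] -> `|s *: a + t *: b| < r0 /\ `|s *: a| < r0.
  rewrite in_itv /= => /andP[s0 st].
  have sa : `|s *: a| <= t * `|a| by rewrite normrZ ger0_norm// ler_wpM2r.
  have tb : `|t *: b| = t * `|b| by rewrite normrZ gtr0_norm.
  split; apply: le_lt_trans tr.
    rewrite (le_trans (ler_normD _ _))// tb /K !mulrDr -addrA lerD//.
    by rewrite lerDl mulr1 ltW.
  by rewrite (le_trans sa)// ler_wpM2l ?(ltW t0)// /K -addrA lerDl addr_ge0.
pose phi s := f (s *: a + (t *: b + x)) - f (s *: a + x).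
pose dphi s := frechet f (s *: a + (t *: b + x)) a - frechet f (s *: a + x) a.
have dline (w : E) s : U (s *: a + w) ->
    is_diff s (fun s => f (s *: a + w)) (fun u => frechet f (s *: a + w) (u *: a)).
  move=> Us.
  have d1 : is_diff s (fun s => s *: a + w) (fun u : R => u *: a).
    have := is_diffD (is_diff_scalel s a) (is_diff_cst w s).
    by rewrite addr0.
  exact: is_diff_comp d1 (frechetP (df _ Us)).
have phiD s : s \in `[0, t] -> is_diff s phi (fun u => u *: dphi s).
  move=> /small[s1 s2].
  have d1 : U (s *: a + (t *: b + x)) by rewrite addrA; apply (Hr _ s1).
  have d2 : U (s *: a + x) by apply (Hr _ s2).
  apply: (is_diff_eq (is_diffB (dline _ _ d1) (dline _ _ d2))).
  apply/funext => u; rewrite fctE.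
  by rewrite /dphi scalerBr; congr (_ - _); exact: linearZ.
have [c ct phiE] : exists2 c, c \in `]0, t[%R & phi t - phi 0 = dphi c * (t - 0).
  apply: MVT => //.
    move=> s /subset_itv_oo_cc st.
    have H := @is_diff_derive _ _ phi s _ (1 : R) (phiD s st); rewrite scale1r in H.
    exact: H.
  apply: continuous_in_subspaceT => s; rewrite inE => /= st.
  by have [/differentiable_continuous] := phiD s st.
have -> : cross_difference f x a b t = phi t - phi 0.
  by rewrite /phi !scale0r !add0r.
have /small[c1 c2] := subset_itv_oo_cc ct.
have [_ H1] := Hr _ c1; have [_ H2] := Hr _ c2.
have Eq : phi t - phi 0 - t ^+ 2 * D b a = t *
   ((frechet f (c *: a + t *: b + x) - frechet f x - D (c *: a + t *: b)) a -
    (frechet f (c *: a + x) - frechet f x - D (c *: a)) a).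
  have -> : D (c *: a + t *: b) = D (c *: a) + t *: D b.
    by rewrite linearD; congr (_ + _); exact: linearZ.
  rewrite phiE subr0 /dphi !clm_subE.
  have alg (X Y Z u v : R) : (X - Y) * t - t ^+ 2 * v =
      t * (X - Z - (u + t * v) - (Y - Z - u)) by ring.
  rewrite addrA; exact: alg.
have t0' := ltW t0.
have ca : `|c *: a| <= t * `|a|.
  have /andP[c0 ct'] : 0 < c < t by move: ct; rewrite in_itv.
  by rewrite normrZ gtr0_norm// ler_wpM2r// ltW.
have cab : `|c *: a + t *: b| <= t * (`|a| + `|b|).
  by rewrite mulrDr (le_trans (ler_normD _ _))// lerD// normrZ ger0_norm.
rewrite Eq normrM ger0_norm//.
have bound (G : dual E) z : `|G| <= e * z -> `|G a| <= e * z * `|a|.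
  by move=> Gz; rewrite (le_trans (clm_norm_le _ _))// ler_wpM2r.
have B1 := bound _ _ (le_trans H1 (ler_wpM2l (ltW e0) cab)).
have B2 := bound _ _ (le_trans H2 (ler_wpM2l (ltW e0) ca)).
have -> : e * t ^+ 2 * ((`|a| + `|b| + `|a|) * `|a|) =
  t * (e * (t * (`|a| + `|b|)) * `|a| + e * (t * `|a|) * `|a|) by ring.
by rewrite ler_wpM2l// (le_trans (ler_normB _ _))// lerD.
Qed.

(** The cross difference is symmetric in a and b, so that t^2 f'' (x) b a and
t^2 f'' (x) a b differ by at most a small multiple of t^2. *)
Lemma second_derivative_sym E (f : E -> R) (U : set E) (x a b : E) :
  open U -> U x -> Ck_on 2 U f ->
  frechet (frechet f) x a b = frechet (frechet f) x b a.
Proof.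
move=> oU Ux Cf; apply/eqP; rewrite -subr_eq0 -normr_le0.
set D := frechet (frechet f) x.
set K := (`|a| + `|b| + `|a|) * `|a| + (`|b| + `|a| + `|b|) * `|b|.
have K0 : 0 <= K by rewrite addr_ge0// mulr_ge0// !addr_ge0.
apply/ler_addgt0Pl => e e0; rewrite addr0.
have e'0 : 0 < e / (K + 1) by rewrite divr_gt0// ltr_wpDl.
have [r1 r10 H1] := cross_difference_approx oU Ux Cf a b e'0.
have [r2 r20 H2] := cross_difference_approx oU Ux Cf b a e'0.
pose t := Num.min r1 r2 / 2.
have m0 : 0 < Num.min r1 r2 by rewrite lt_min r10.
have t0 : 0 < t by rewrite divr_gt0.
have tm : t < Num.min r1 r2 by rewrite ltr_pdivrMr// mulr_natr mulr2n ltrDl.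
have /(H1 _ t0) {}H1 : t < r1 by rewrite (lt_le_trans tm)// ge_min lexx.
have /(H2 _ t0) {}H2 : t < r2 by rewrite (lt_le_trans tm)// ge_min lexx orbT.
have sym : cross_difference f x b a t = cross_difference f x a b t.
  rewrite /cross_difference [t *: b + (_ + x)]addrCA; ring.
rewrite sym in H2.
have t20 : 0 < t ^+ 2 by rewrite exprn_gt0.
rewrite -(ler_pM2l t20) -[X in X * `|_|]gtr0_norm// -normrM.
have -> : t ^+ 2 * (D a b - D b a) =
  (cross_difference f x a b t - t ^+ 2 * D b a) -
  (cross_difference f x a b t - t ^+ 2 * D a b) by ring.
rewrite (le_trans (ler_normB _ _))// (le_trans (lerD H1 H2))//.
rewrite -mulrDr -/K mulrAC [leRHS]mulrC ler_wpM2r ?(ltW t20)//.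
by rewrite mulrAC ler_pdivrMr ?ltr_wpDl// ler_wpM2l ?(ltW e0)// lerDl.
Qed.

End SecondDerivative.

(** * Charts and their products *)

Section Charts.
Context {R : realType}.
Implicit Types E F : normedModType R.

Lemma of_model_image E (M : topologicalType) (c : chart M E) y : is_chart c ->
  (to_model c @` dom c) y -> dom c (of_model c y) /\ to_model c (of_model c y) = y.
Proof. by move=> [_ _ cK _ _] [x cx <-]; rewrite cK. Qed.

Lemma open_to_model E (M : topologicalType) (c : chart M E) (W : set M) :
  is_chart c -> open W -> open (to_model c @` (dom c `&` W)).
Proof.
move=> cP oW; have [oD oI cK ct cof] := cP.
suff -> : to_model c @` (dom c `&` W) =
    (to_model c @` dom c) `&` of_model c @^-1` W by exact: open_setI_preimage.
apply/seteqP; split=> [_ [x [cx Wx] <-]|y [Iy Wy]].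
  by split; [exists x|rewrite /preimage /= cK].
by have [Dy yE] := of_model_image cP Iy; exists (of_model c y).
Qed.

Lemma near_of_model E (M : topologicalType) (c : chart M E) x (P : M -> Prop) :
  is_chart c -> dom c x -> (\forall z \near x, P z) ->
  \forall y \near to_model c x, P (of_model c y).
Proof.
move=> cP cx; have [oD oI cK ct cof] := cP.
have := cof (to_model c x) (imageP _ cx).
by rewrite /prop_for /continuous_at cK//; apply.
Qed.

Lemma near_image E (M : topologicalType) (c : chart M E) x :
  is_chart c -> dom c x -> \forall y \near to_model c x, (to_model c @` dom c) y.
Proof.
by move=> [oD oI _ _ _] cx; apply: open_nbhs_nbhs; split=> //; exact: imageP.
Qed.

Lemma near_dom E (M : topologicalType) (c : chart M E) x :
  is_chart c -> dom c x -> \forall z \near x, dom c z.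
Proof. by move=> [oD _ _ _ _] cx; exact: open_nbhs_nbhs. Qed.

(** The form in which manifolds enter the calculus; it passes to products
([prod_atlas]). *)
Definition smooth_atlas E (M : charted E) :=
  (forall x : M, is_chart (chart_at x) /\ dom (chart_at x) x) /\
  (forall x y : M, smooth_transition (chart_at x) (chart_at y)).

Lemma manifold_atlas E (M : charted E) : is_manifold M -> smooth_atlas M.
Proof. by case. Qed.

Lemma vs_atlas E : smooth_atlas (vs_charted E).
Proof.
have idE : id @` [set: E] = setT by rewrite image_id.
split=> [x|x y]; last by move=> k; exact: Ck_on_id.
split=> //; split=> //.
- exact: openT.
- by rewrite [X in open X]idE; exact: openT.
- by move=> y _; exact: cvg_id.
- by move=> y _; exact: cvg_id.
Qed.

Lemma image_prod (T1 T2 T3 T4 : Type) (f : T1 -> T3) (g : T2 -> T4) A B :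
  (fun x => (f x.1, g x.2)) @` (A `*` B) = (f @` A) `*` (g @` B).
Proof.
apply/seteqP; split=> [_ [[a b] [/= Aa Bb] <-]|[_ _] [/= [a Aa <-] [b Bb <-]]].
  by split; [exists a|exists b].
by exists (a, b).
Qed.

Lemma open_prod (T1 T2 : topologicalType) (A : set T1) (B : set T2) :
  open A -> open B -> open (A `*` B).
Proof.
move=> oA oB; rewrite openE => -[a b] [/= Aa Bb].
exists (A, B) => //=.
by split; exact: open_nbhs_nbhs.
Qed.

Lemma continuous_prod (T1 T2 T3 T4 : topologicalType) (f : T1 -> T3) (g : T2 -> T4) x :
  {for x.1, continuous f} -> {for x.2, continuous g} ->
  {for x, continuous (fun z => (f z.1, g z.2))}.
Proof.
move=> cf cg; apply: cvg_pair => /=.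
  by apply: (@continuous_comp _ _ _ fst f) => //; exact: cvg_fst.
by apply: (@continuous_comp _ _ _ snd g) => //; exact: cvg_snd.
Qed.

Lemma is_chart_prod E F (M N : topologicalType) (c : chart M E) (d : chart N F) :
  is_chart c -> is_chart d -> is_chart (prod_chart c d).
Proof.
move=> [oD oI cK ct cof] [oD' oI' cK' ct' cof'].
have imE : to_model (prod_chart c d) @` dom (prod_chart c d) =
  (to_model c @` dom c) `*` (to_model d @` dom d) by exact: image_prod.
split; rewrite ?imE; try exact: open_prod.
- by move=> [x y] [/= cx dy]; rewrite cK// cK'.
- move=> [x y] [/= cx dy].
  by apply: continuous_prod; [exact: ct|exact: ct'].
- move=> [x y] [/= cx dy].
  by apply: continuous_prod; [exact: cof|exact: cof'].
Qed.

Lemma smooth_on_prod E F E' F' (U : set E) (V : set F) (f : E -> E') (g : F -> F') :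
  open U -> open V -> smooth_on U f -> smooth_on V g ->
  smooth_on (U `*` V) (fun z => (f z.1, g z.2)).
Proof.
move=> oU oV Cf Cg k; have oUV := open_prod oU oV; apply: Ck_on_pair => //.
  have := @smooth_on_comp _ _ _ _ (U `*` V) (U `*` V) U f fst oUV oU Cf.
  apply=> //; last by move=> z [].
  by move=> k'; exact: Ck_on_fst.
have := @smooth_on_comp _ _ _ _ (U `*` V) (U `*` V) V g snd oUV oV Cg.
apply=> //; last by move=> z [].
by move=> k'; exact: Ck_on_snd.
Qed.

Lemma smooth_transition_prod E F (M N : topologicalType) (c c' : chart M E)
    (d d' : chart N F) :
  is_chart c -> is_chart d -> is_chart c' -> is_chart d' ->
  smooth_transition c c' -> smooth_transition d d' ->
  smooth_transition (prod_chart c d) (prod_chart c' d').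
Proof.
move=> cP dP [oc' _ _ _ _] [od' _ _ _ _] cc' dd'.
have := smooth_on_prod (open_to_model cP oc') (open_to_model dP od') cc' dd'.
rewrite /smooth_transition; congr smooth_on; rewrite -image_prod; congr image.
by apply/seteqP; split=> -[x y] /= [[? ?] [? ?]].
Qed.

End Charts.

(** * Tangent maps *)

Section TangentMaps.
Context {R : realType}.
Implicit Types E F H : normedModType R.

Lemma prod_atlas E F (M : charted E) (N : charted F) :
  smooth_atlas M -> smooth_atlas N -> smooth_atlas (prod_charted M N).
Proof.
move=> [cM tM] [cN tN]; split=> [x|x y].
  have [cx dx] := cM x.1; have [cy dy] := cN x.2.
  split; [exact: is_chart_prod|by split].
have [cx _] := cM x.1; have [cy _] := cN x.2.
have [cx' _] := cM y.1; have [cy' _] := cN y.2.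
exact: (smooth_transition_prod cx cy cx' cy' (tM _ _) (tN _ _)).
Qed.

Lemma local_repE E F (M : charted E) (N : charted F) (f : M -> N) x y :
  local_rep f x y = to_model (chart_at (f x)) (f (of_model (chart_at x) y)).
Proof. by []. Qed.

Section Maps.
Context E F H (M : charted E) (N : charted F) (P : charted H).
Hypotheses (aM : smooth_atlas M) (aN : smooth_atlas N).

Let chartM (x : M) : is_chart (chart_at x). Proof. by case: (aM.1 x). Qed.
Let domM (x : M) : dom (chart_at x) x. Proof. by case: (aM.1 x). Qed.
Let chartN (x : N) : is_chart (chart_at x). Proof. by case: (aN.1 x). Qed.
Let domN (x : N) : dom (chart_at x) x. Proof. by case: (aN.1 x). Qed.

Lemma at_chartK (x : M) : of_model (chart_at x) (to_model (chart_at x) x) = x.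
Proof. by have [_ _ cK _ _] := chartM x; rewrite cK. Qed.

Lemma local_rep_at (f : M -> N) x :
  local_rep f x (to_model (chart_at x) x) = to_model (chart_at (f x)) (f x).
Proof. by rewrite local_repE at_chartK. Qed.

(** Near x the inner chart at f x cancels, by continuity of f. *)
Lemma local_rep_comp (f : M -> N) (g : N -> P) x : {for x, continuous f} ->
  \forall y \near to_model (chart_at x) x,
    (local_rep g (f x) \o local_rep f x) y = local_rep (g \o f) x y.
Proof.
move=> cf; have /(near_of_model (chartM x) (domM x)) :
    \forall z \near x, dom (chart_at (f x)) (f z).
  exact: (cf _ (near_dom (chartN (f x)) (domN (f x)))).
apply: filterS => y Dy; rewrite /= !local_repE.
by have [_ _ cK _ _] := chartN (f x); rewrite cK.
Qed.

Lemma mdifferentiable_comp (f : M -> N) (g : N -> P) x :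
  mdifferentiable f x -> mdifferentiable g (f x) -> mdifferentiable (g \o f) x.
Proof.
move=> [cf df] [cg dg]; split; first exact: continuous_comp.
apply: differentiable_near (local_rep_comp g cf) _.
by apply: differentiable_comp => //; rewrite local_rep_at.
Qed.

Lemma tmap_comp (f : M -> N) (g : N -> P) x :
  mdifferentiable f x -> mdifferentiable g (f x) ->
  tmap (g \o f) x = clm_comp (tmap g (f x)) (tmap f x).
Proof.
move=> [cf df] [cg dg].
have dg' : differentiable (local_rep g (f x))
    (local_rep f x (to_model (chart_at x) x)) by rewrite local_rep_at.
rewrite /tmap -(frechet_near (local_rep_comp g cf)).
  by rewrite (frechet_comp df dg') local_rep_at.
exact: differentiable_comp.
Qed.

Lemma near_local_rep_id x :
  \forall y \near to_model (chart_at x) x, y = local_rep (id : M -> M) x y.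
Proof.
have := near_image (chartM x) (domM x); apply: filterS => y Iy.
by rewrite local_repE (of_model_image (chartM x) Iy).2.
Qed.

Lemma tmap_id x : tmap (id : M -> M) x = id_clm E.
Proof. by rewrite /tmap -(frechet_near (near_local_rep_id x))// frechet_id. Qed.

Lemma smooth_map_mdifferentiable (f : M -> N) x :
  smooth_map f -> mdifferentiable f x.
Proof.
move=> [cf Cf]; split; first exact: cf.
apply: (smooth_on_differentiable (Cf x (f x))).
by exists x => //; split; [exact: domM|exact: domN].
Qed.

(** The local representative of the inverse of a chart is a change of charts. *)
Lemma mdifferentiable_of_model (p : M) y :
  (to_model (chart_at p) @` dom (chart_at p)) y ->
  mdifferentiable (of_model (chart_at p) : vs_charted E -> M) y.
Proof.
move=> Iy; have [_ _ cK _ cof] := chartM p; split; first exact: cof.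
apply: (smooth_on_differentiable (aM.2 p (of_model (chart_at p) y))).
have [Dy yE] := of_model_image (chartM p) Iy.
by exists (of_model (chart_at p) y) => //; split => //; exact: domM.
Qed.

End Maps.

Section Partial.
Context E F (M : charted E) (N : charted F).
Hypotheses (aM : smooth_atlas M) (aN : smooth_atlas N).

Lemma mdifferentiable_pair1 (x : M) (y : N) :
  mdifferentiable (fun z => (z, y) : prod_charted M N) x.
Proof.
split; first by apply: cvg_pair => //; exact: cvg_cst.
apply: (differentiable_near (f := fun z => (z, to_model (chart_at y) y))) => //.
by have := near_local_rep_id aM x; apply: filterS => z zE; congr (_, _).
Qed.

Lemma tmap_pair1 (x : M) (y : N) :
  tmap (fun z => (z, y) : prod_charted M N) x = inl_clm E F.
Proof.
have nE : \forall z \near to_model (chart_at x) x,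
  (z, to_model (chart_at y) y) = local_rep (fun z => (z, y) : prod_charted M N) x z.
  by have := near_local_rep_id aM x; apply: filterS => z zE; congr (_, _).
have d : is_diff (to_model (chart_at x) x)
    (fun z => (z, to_model (chart_at y) y)) (inl_clm E F).
  apply: (is_diff_eq (is_diff_pair (is_diff_id _) (is_diff_cst _ _))).
  by apply/funext => v; rewrite inl_clmE.
rewrite /tmap -(frechet_near nE); first exact: is_diff_frechet.
by case: d.
Qed.

Lemma mdifferentiable_pair2 (x : M) (y : N) :
  mdifferentiable (fun z => (x, z) : prod_charted M N) y.
Proof.
split; first by apply: cvg_pair => //; exact: cvg_cst.
apply: (differentiable_near (f := fun z => (to_model (chart_at x) x, z))) => //.
by have := near_local_rep_id aN y; apply: filterS => z zE; congr (_, _).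
Qed.

Lemma tmap_pair2 (x : M) (y : N) :
  tmap (fun z => (x, z) : prod_charted M N) y = inr_clm E F.
Proof.
have nE : \forall z \near to_model (chart_at y) y,
  (to_model (chart_at x) x, z) = local_rep (fun z => (x, z) : prod_charted M N) y z.
  by have := near_local_rep_id aN y; apply: filterS => z zE; congr (_, _).
have d : is_diff (to_model (chart_at y) y)
    (fun z => (to_model (chart_at x) x, z)) (inr_clm E F).
  apply: (is_diff_eq (is_diff_pair (is_diff_cst _ _) (is_diff_id _))).
  by apply/funext => v; rewrite inr_clmE.
rewrite /tmap -(frechet_near nE); first exact: is_diff_frechet.
by case: d.
Qed.

End Partial.
End TangentMaps.

Section TangentOfChart.
Context {R : realType} {E : normedModType R} (M : charted E).
Hypothesis aM : smooth_atlas M.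

Lemma tmap_of_model (p : M) :
  tmap (of_model (chart_at p) : vs_charted E -> M) (to_model (chart_at p) p) =
  id_clm E.
Proof.
have cP := (aM.1 p).1; have dP := (aM.1 p).2.
rewrite /tmap -[RHS](frechet_id (to_model (chart_at p) p)).
apply/esym/frechet_near; last by have [] := is_diff_id (to_model (chart_at p) p).
have := near_image cP dP; apply: filterS => y Iy.
by rewrite local_repE (at_chartK aM) (of_model_image cP Iy).2.
Qed.

Lemma open_image_chart (p : M) : open (to_model (chart_at p) @` dom (chart_at p)).
Proof. by case: (aM.1 p).1. Qed.

Lemma image_chart_at (p : M) :
  (to_model (chart_at p) @` dom (chart_at p)) (to_model (chart_at p) p).
Proof. by exists p => //; exact: (aM.1 p).2. Qed.

End TangentOfChart.

(** * Submanifolds that are graphs in a chart *)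

Section ChartDiffeo.
Context {R : realType} {E : normedModType R} (M : charted E).
Hypothesis aM : smooth_atlas M.
Variables (p : M) (s s' : E -> E).
Local Notation D := (to_model (chart_at p) @` dom (chart_at p)).
Hypotheses (Cs : smooth_on D s) (Cs' : smooth_on D s').
Hypotheses (Ds : forall y, D y -> D (s y)) (Ds' : forall y, D y -> D (s' y)).
Hypotheses (sK : forall y, D y -> s' (s y) = y) (s'K : forall y, D y -> s (s' y) = y).

(** The preferred chart at p followed by the diffeomorphism s of its image, with
inverse s'. *)
Definition transported_chart : chart M E :=
  Chart (dom (chart_at p)) (s \o to_model (chart_at p)) (of_model (chart_at p) \o s').

Let cP : is_chart (chart_at p). Proof. exact: (aM.1 p).1. Qed.
Let oD : open D. Proof. exact: open_image_chart. Qed.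

Lemma image_transported_chart : to_model transported_chart @` dom transported_chart = D.
Proof.
apply/seteqP; split=> [_ [x Dx <-]|y Dy]; first by apply: Ds; exists x.
have [x Dx xE] := Ds' Dy; exists x => //=.
by rewrite xE s'K.
Qed.

Lemma is_chart_transported : is_chart transported_chart.
Proof.
have [oDom oI cK ct cof] := cP.
split; rewrite ?image_transported_chart//=.
- by move=> x Dx; rewrite sK ?cK//; exists x.
- move=> x Dx; apply: continuous_comp; first exact: ct.
  by apply: differentiable_continuous; apply: smooth_on_differentiable Cs _ _; exists x.
- move=> y Dy; apply: continuous_comp; last by apply: cof; exact: Ds'.
  by apply: differentiable_continuous; exact: smooth_on_differentiable Cs' _ _.
Qed.

Lemma transported_chart_compatible (x : M) :
  smooth_transition transported_chart (chart_at x) /\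
  smooth_transition (chart_at x) transported_chart.
Proof.
have [oDp _ cK _ _] := cP; have [oDx _ _ _ _] := (aM.1 x).1.
split.
  have := smooth_on_comp oD (open_to_model cP oDx) (aM.2 p x) Cs'.
  apply=> [_ [z [Dz _] <-]|_ [z [Dz xz] <-]]; first by apply: Ds; exists z.
  by rewrite /= sK; exists z.
have oW : open (to_model (chart_at x) @` (dom (chart_at x) `&` dom (chart_at p))).
  by apply: open_to_model => //; exact: (aM.1 x).1.
have := smooth_on_comp oW oD Cs (aM.2 x p).
apply=> // _ [z [xz Dz] <-] /=.
by have [_ _ xK _ _] := (aM.1 x).1; rewrite xK//; exists z.
Qed.

End ChartDiffeo.

Section Graphs.
Context {R : realType} {E : normedModType R} (M : charted E).
Hypothesis aM : smooth_atlas M.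
Variable S : set M.

(** In the preferred chart at p, S is the graph q y = f y of a function from the
kernel of the projector q to its range. The function f is defined on the whole
chart image, but does not depend on the component along the range of q. *)
Record chart_graph (p : M) (q : 'L(E, E)) (f : E -> E) : Prop := ChartGraph {
  graph_idem : forall v, q (q v) = q v ;
  graph_range : forall y, q (f y) = f y ;
  graph_indep : forall y w, f (y + q w) = f y ;
  graph_dom : forall y w, (to_model (chart_at p) @` dom (chart_at p)) y ->
    (to_model (chart_at p) @` dom (chart_at p)) (y + q w) ;
  graph_smooth : smooth_on (to_model (chart_at p) @` dom (chart_at p)) f ;
  graph_mem : forall z, dom (chart_at p) z ->
    S z <-> q (to_model (chart_at p) z) = f (to_model (chart_at p) z) }.

Section AtPoint.
Variables (p : M) (q : 'L(E, E)) (f : E -> E).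
Hypothesis Sf : chart_graph p q f.
Local Notation D := (to_model (chart_at p) @` dom (chart_at p)).

Let oD : open D. Proof. exact: open_image_chart. Qed.

(** The shear y |-> y - f y is a diffeomorphism of the chart image with inverse
y |-> y + f y, because f does not see the component along the range of q; it
maps the graph to the kernel of q. *)
Lemma chart_graph_straighten : exists (c : chart M E) (q : 'L(E, E)),
    [/\ is_chart c, dom c p,
        forall x : M, smooth_transition c (chart_at x) /\
                      smooth_transition (chart_at x) c,
        forall v, q (q v) = q v &
        to_model c @` (dom c `&` S) =
          to_model c @` dom c `&` [set v | q v = 0]].
Proof.
have [qq qf fq Dq Cf SE] := Sf.
(* s (-1) is the shear and s 1 its inverse *)
pose s (a : R) y := y + a *: f y.
have sE a y : s a y = y + q (a *: f y) by rewrite linearZ /= qf.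
have Cs a : smooth_on D (s a).
  move=> k; apply: Ck_on_add => //; first exact: Ck_on_id.
  have := @smooth_on_comp _ _ _ _ D D setT ( *:%R a) f oD openT _ Cf _ _ k.
  apply=> // k'.
  pose A : 'L(E, E) := a *: id_clm E.
  have -> : *:%R a = A by apply/funext => z; rewrite clm_scaleE id_clmE.
  exact: Ck_on_clm.
have Ds a y : D y -> D (s a y) by move=> Dy; rewrite sE; exact: Dq.
have sK a y : s (- a) (s a y) = y.
  by rewrite {1}/s sE fq -sE /s scaleNr addrK.
have sK' y : s 1 (s (-1) y) = y by have := sK (-1) y; rewrite opprK.
exists (transported_chart p (s (-1)) (s 1)), q; split=> //.
- apply: (is_chart_transported aM (Cs _) (Cs _) (Ds _) (Ds _)) => y _; [exact: sK'|exact: sK].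
- exact: (aM.1 p).2.
- apply: (transported_chart_compatible aM (Cs _) (Cs _) (Ds _)) => y _; exact: sK'.
- have qs y : q (s (-1) y) = q y - f y.
    by rewrite /s scaleN1r linearB /= qf.
  apply/seteqP; split=> [_ [z [Dz Sz] <-]|_ [[z Dz <-] qz0]].
    split; first by exists z.
    by rewrite /= qs ((SE z Dz).1 Sz) subrr.
  exists z => //; split=> //; apply/(SE z Dz).
  by move/eqP: qz0; rewrite /= qs subr_eq0 => /eqP.
Qed.

(** Differentiating q y = f y along a curve in S gives one inclusion. For the
other one, h y = y - (q y - f y) retracts the chart image onto the graph, and
its derivative fixes each v with q v = f' v: the image under h of a straight line
with velocity v is a curve in S with velocity v. *)
Lemma chart_graph_tangent : S p ->
  tangent_to S p = [set v | q v = frechet f (to_model (chart_at p) p) v].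
Proof.
have [qq qf fq Dq Cf SE] := Sf => Sp.
have cP := (aM.1 p).1; have dp := (aM.1 p).2.
set y0 := to_model (chart_at p) p.
have Dy0 : D y0 by exists p.
have df : is_diff y0 f (frechet f y0).
  by apply: frechetP; exact: smooth_on_differentiable Cf _ _.
apply/seteqP; split=> [v [c [c0 Sc [cc dc] cv]]|v /= qv].
  pose cl := local_rep (c : vs_charted R -> M) 0.
  have cl0 : cl 0 = y0 by rewrite /cl local_repE c0.
  have clE t : cl t = to_model (chart_at p) (c t) by rewrite /cl local_repE c0.
  have dcl : is_diff (0 : R) cl (frechet cl 0) by exact: frechetP.
  have nE : \forall t \near (0 : R), q (cl t) = f (cl t).
    have nD : \forall t \near (0 : R), dom (chart_at p) (c t).
      by apply: cc; rewrite c0; exact: near_dom.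
    by near=> t; rewrite clE; apply/SE; near: t.
  have dq : is_diff (0 : R) (q \o cl) (q \o frechet cl 0).
    by apply: is_diff_comp; exact: is_diff_clm.
  have dfc : is_diff (0 : R) (f \o cl) (frechet f y0 \o frechet cl 0).
    by rewrite -cl0 in df *; exact: is_diff_comp.
  have /is_diff_frechetE H1 := is_diff_near nE dq.
  have /is_diff_frechetE H2 := dfc.
  have H := congr1 (fun h : R -> E => h 1) (etrans (esym H1) H2).
  by rewrite /= -cv; exact: H.
pose h y := y - (q y - f y).
have hE y : h y = y + q (f y - y) by rewrite linearB /= qf /h opprB.
have dh : is_diff y0 h (fun w => w - (q w - frechet f y0 w)).
  exact: is_diffB (is_diff_id y0) (is_diffB (is_diff_clm q y0) df).
pose s (t : R) := h (t *: v + y0).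
have s0 : s 0 = y0.
  by rewrite /s scale0r add0r /h ((SE p dp).1 Sp) subrr subr0.
have dline : is_diff (0 : R) (fun t => t *: v + y0) (fun t : R => t *: v).
  have := is_diffD (is_diff_scalel 0 v) (is_diff_cst y0 (0 : R)).
  by rewrite addr0.
have ds : is_diff (0 : R) s
    ((fun w => w - (q w - frechet f y0 w)) \o (fun t : R => t *: v)).
  by apply: is_diff_comp; rewrite scale0r add0r.
have ms : mdifferentiable (s : vs_charted R -> vs_charted E) 0.
  by have [d _] := ds; split=> //; exact: differentiable_continuous.
have mo : mdifferentiable (of_model (chart_at p) : vs_charted E -> M) (s 0).
  by rewrite s0; exact: mdifferentiable_of_model.
exists (of_model (chart_at p) \o s); split.
- by rewrite /= s0 at_chartK.
- have nD : \forall t \near (0 : R), D (t *: v + y0).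
    have [/differentiable_continuous c _] := dline.
    by apply: c; rewrite scale0r add0r; exact: open_nbhs_nbhs.
  apply: filterS nD => t Dt.
  have Dh : D (s t) by rewrite /s hE; exact: Dq.
  have [Ds sE] := of_model_image cP Dh.
  apply/SE => //; rewrite sE /s [in RHS]hE fq /h linearB linearB /= qf qq.
  by rewrite opprB addrCA subrr addr0.
- exact: (mdifferentiable_comp (vs_atlas R) (vs_atlas E) ms mo).
- rewrite /velocity (tmap_comp (vs_atlas R) (vs_atlas E) ms mo).
  rewrite clm_compE s0 tmap_of_model// id_clmE.
  have /is_diff_frechetE H := ds.
  apply: (etrans (congr1 (fun h : R -> E => h 1) H)) => /=.
  by rewrite scale1r qv subrr subr0.
Unshelve. all: by end_near. Qed.

End AtPoint.
End Graphs.

(** * The one-form and the set S *)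

Section LieGroupFacts.
Context {R : realType} {E : normedModType R} (G : lie_group E).
Implicit Types (g h : G) (xi : E) (mu nu : dual E).

Lemma lie_atlas : smooth_atlas G.
Proof. exact/manifold_atlas/lie_manifold. Qed.

Lemma lmulgV g : lmul g (linv g) = lone G.
Proof.
rewrite -[LHS](lmul1) -[in LHS](lmulV (linv g)) -(lmulA (linv (linv g))).
by rewrite (lmulA (linv g)) lmulV lmul1 lmulV.
Qed.

Lemma lmulg1 g : lmul g (lone G) = g.
Proof. by rewrite -(lmulV g) lmulA lmulgV lmul1. Qed.

Lemma mdifferentiable_rmul g h : mdifferentiable (rmul g : G -> G) h.
Proof.
have aG := lie_atlas; have aGG := prod_atlas aG aG.
have := mdifferentiable_comp aG aGG (mdifferentiable_pair1 aG h g)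
  (smooth_map_mdifferentiable aGG aG (h, g) (lmul_smooth G)).
by [].
Qed.

Lemma TrinvK g v : Trinv g (Tr g v) = v.
Proof.
have aG := lie_atlas; rewrite -clm_compE /Trinv /Tr.
have rE : rmul g (lone G) = g by rewrite /rmul lmul1.
have := tmap_comp aG aG (mdifferentiable_rmul g (lone G))
  (mdifferentiable_rmul (linv g) (rmul g (lone G))).
rewrite rE => <-.
have -> : rmul (linv g) \o rmul g = id.
  by apply/funext => h /=; rewrite /rmul -lmulA lmulgV lmulg1.
by rewrite tmap_id// id_clmE.
Qed.

Lemma TrK g v : Tr g (Trinv g v) = v.
Proof.
have aG := lie_atlas; rewrite -clm_compE /Trinv /Tr.
have rE : rmul (linv g) g = lone G by rewrite /rmul lmulgV.
have := tmap_comp aG aG (mdifferentiable_rmul (linv g) g)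
  (mdifferentiable_rmul g (rmul (linv g) g)).
rewrite rE => <-.
have -> : rmul g \o rmul (linv g) = id.
  by apply/funext => h /=; rewrite /rmul -lmulA lmulV lmulg1.
by rewrite tmap_id// id_clmE.
Qed.

(** The bracket is absorbed by V_xi = xi_3 + [xi, xi_2]. The first component of
the equation for the decomposition of V gives xi_2 = T R_(g^-1) V_g; the other
components always have a solution. *)
Lemma theta2E g mu xi nu (V : (E * dual E) * (E * dual E)) :
  theta2 (((g, mu), (xi, nu)) : tulczyjew G) V = mu V.2.1 + nu (Trinv g V.1.1).
Proof.
case: V => -[Vg Vm] [Vx Vn] /=; rewrite /theta2 /=.
set P := [set c | _].
have : P (xget 0 P).
  apply: xgetPex; exists ((Trinv g Vg, Vm - ad_star G (Trinv g Vg) mu),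
    (Vx - lie_bracket G xi (Trinv g Vg),
     Vn - ad_star G (Trinv g Vg) nu + ad_star G xi (Vm - ad_star G (Trinv g Vg) mu))).
  by rewrite /P /= TrK subrK subrK addrAC addrK subrK.
case: (xget 0 P) => -[xi2 nu2] [xi3 nu3]; rewrite /P /= => -[<- _ <- _].
rewrite TrinvK; move: (lie_bracket G xi xi2) => z; by rewrite linearD addrAC.
Qed.

Lemma tulczyjew_atlas : smooth_atlas (tulczyjew G).
Proof.
apply: prod_atlas; apply: prod_atlas; try exact: vs_atlas.
exact: lie_atlas.
Qed.

Lemma GxE_atlas : smooth_atlas (GxE G).
Proof. by apply: prod_atlas; [exact: lie_atlas|exact: vs_atlas]. Qed.

Definition config_proj : 'L(((E * dual E) * (E * dual E))%type, (E * E)%type) := clm_of (fun y => (y.1.1, y.2.1)).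

Lemma config_projE y : config_proj y = (y.1.1, y.2.1).
Proof.
rewrite /config_proj (@bounded_clm_of _ _ _ _ 1)// => u.
by rewrite mul1r !prod_normE /= ge_max !le_max !lexx !orbT.
Qed.

Lemma tmap_proj (p : tulczyjew G) (V : (E * dual E) * (E * dual E)) :
  tmap (@tulczyjew_proj R E G) p V = (V.1.1, V.2.1).
Proof.
rewrite -(config_projE V); congr clm_fun; apply: is_diff_frechet.
apply: (is_diff_near _ (is_diff_clm config_proj _)).
have := near_local_rep_id tulczyjew_atlas p; apply: filterS => y yE.
by rewrite config_projE {1}yE.
Qed.

Section Lagrangian.
Variable L : GxE G -> R.
Hypothesis L_smooth : smooth_map (L : GxE G -> vs_charted R).

Let L_mdiff p : mdifferentiable (L : GxE G -> vs_charted R) p.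
Proof. exact: (smooth_map_mdifferentiable GxE_atlas (vs_atlas _)). Qed.

Lemma dL_dgE g xi :
  dL_dg L g xi = clm_comp (tmap (L : GxE G -> vs_charted R) (g, xi)) (inl_clm E E).
Proof.
rewrite -(tmap_pair1 lie_atlas (g : G) (xi : vs_charted E)).
rewrite -(tmap_comp lie_atlas GxE_atlas)//.
by apply: mdifferentiable_pair1; exact: lie_atlas.
Qed.

Lemma dL_dxiE g xi :
  dL_dxi L g xi = clm_comp (tmap (L : GxE G -> vs_charted R) (g, xi)) (inr_clm E E).
Proof.
rewrite -(tmap_pair2 (vs_atlas E) (g : G) (xi : vs_charted E)).
rewrite -(tmap_comp (vs_atlas E) GxE_atlas)//.
by apply: mdifferentiable_pair2; exact: vs_atlas.
Qed.

Lemma differentialE g xi v :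
  differential L ((g, xi) : GxE G) v = dL_dg L g xi v.1 + dL_dxi L g xi v.2.
Proof.
rewrite dL_dgE dL_dxiE !clm_compE -linearD inl_clmE inr_clmE.
by case: v => a b; congr (tmap _ _ _); congr (_, _); rewrite /= ?addr0 ?add0r.
Qed.

Lemma lagrangian_setP g mu xi nu :
  lagrangian_set L ((g, mu), (xi, nu)) <->
  mu = dL_dxi L g xi /\ nu = Tr_dual g (dL_dg L g xi).
Proof.
have pE m n V : pullback (@tulczyjew_proj R E G) (differential L) ((g, m), (xi, n)) V =
    dL_dg L g xi V.1.1 + dL_dxi L g xi V.2.1.
  by rewrite /pullback tmap_proj differentialE.
have TE (a : dual E) v : Tr_dual g a (Trinv g v) = a v.
  by rewrite /Tr_dual clm_compE TrK.
split=> [H|[-> ->]]; last first.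
  have pullbackE V :
      theta2 (((g, dL_dxi L g xi), (xi, Tr_dual g (dL_dg L g xi))) : tulczyjew G) V =
      dL_dxi L g xi V.2.1 + dL_dg L g xi V.1.1.
    by rewrite theta2E; congr (_ + _); exact: TE.
  rewrite /lagrangian_set /mkset; apply/funext => V.
  exact: etrans (pE _ _ V) (etrans (addrC _ _) (esym (pullbackE V))).
apply: (dual_pair_inj (TrinvK g)) => a b.
have HV : dL_dg L g xi a + dL_dxi L g xi b = mu b + nu (Trinv g a).
  rewrite -(theta2E g mu xi nu ((a, 0), (b, 0))) -(pE mu nu ((a, 0), (b, 0))).
  by rewrite H.
by rewrite TE -HV addrC.
Qed.

(** The open set I lets the equation mu = dL/dxi be differentiated: it holds near
each of its points, so the derivative of dL/dxi is that of mu. *)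
Lemma lagrangian_set_velocity (I : set R) (g : R -> G) (mu : R -> dual E) :
  open I -> 
  (forall t, I t ->
       mdifferentiable (mu : vs_charted R -> vs_charted (dual E)) t) ->
    let xi t := Trinv (g t) (velocity g t) in
    (forall t, I t ->
       lagrangian_set L
         (trivialization (g t, mu t)
            (velocity g t, velocity (mu : R -> vs_charted (dual E)) t))) <->
    (forall t, I t -> mu t = dL_dxi L (g t) (xi t)) /\
    (forall t, I t ->
       is_derive t 1 (fun s => dL_dxi L (g s) (xi s))
         (Tr_dual (g t) (dL_dg L (g t) (xi t))
          + ad_star G (xi t) (dL_dxi L (g t) (xi t)))).
Proof.
move=> oI dmu xi.
have dmuE t : I t ->
    is_derive t 1 mu (velocity (mu : R -> vs_charted (dual E)) t).
  by move=> /dmu[_ /frechetP H]; exact: (is_diff_derive _ H).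
have near_mu t : I t -> (forall t, I t -> mu t = dL_dxi L (g t) (xi t)) ->
    \forall s \near t, mu s = dL_dxi L (g s) (xi s).
  by move=> It muE; exact: open_near muE.
split=> [H|[muE EL] t It].
  have muE t : I t -> mu t = dL_dxi L (g t) (xi t).
    by move=> /H /lagrangian_setP[].
  split=> // t It; have /lagrangian_setP[_ nuE] := H t It.
  apply: (near_eq_is_derive (near_mu t It muE)).
  rewrite -nuE -muE// subrK; exact: dmuE.
apply/lagrangian_setP; split; first exact: muE.
have e1 := dmuE t It; have e2 := EL t It.
have /near_eq_derive e3 := near_mu t It muE.
have := e3 1; rewrite (@derive_val _ _ _ _ _ _ _ e1) (@derive_val _ _ _ _ _ _ _ e2).
by move=> /= ->; rewrite -muE// addrK.
Qed.

End Lagrangian.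
End LieGroupFacts.

(** * The multiplication in a chart *)

Section LocalRepresentation.
Context {R : realType} {E : normedModType R} (G : lie_group E).
Variable g0 : G.

Definition chart_image : set E := to_model (chart_at g0) @` dom (chart_at g0).
Definition point_of (u : E) : G := of_model (chart_at g0) u.

Let aG := lie_atlas G.
Let cG (g : G) : is_chart (chart_at g). Proof. by case: (aG.1 g). Qed.
Let dG (g : G) : dom (chart_at g) g. Proof. by case: (aG.1 g). Qed.

Lemma open_chart_image : open chart_image.
Proof. exact: open_image_chart. Qed.

Definition config_image : set (E * E) := chart_image `*` setT.

Lemma open_config_image : open config_image.
Proof. by apply: open_prod; [exact: open_chart_image|exact: openT]. Qed.

Lemma point_ofK g : dom (chart_at g0) g ->
  point_of (to_model (chart_at g0) g) = g.
Proof. by case: (cG g0) => _ _ cK _ _ /cK. Qed.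

Lemma dom_point_of u : chart_image u -> dom (chart_at g0) (point_of u).
Proof. by move=> /(of_model_image (cG g0))[]. Qed.

Lemma point_of_inv u : chart_image u -> to_model (chart_at g0) (point_of u) = u.
Proof. by move=> /(of_model_image (cG g0))[]. Qed.

Lemma mdifferentiable_point_of u : chart_image u ->
  mdifferentiable (point_of : vs_charted E -> G) u.
Proof. exact: mdifferentiable_of_model. Qed.

Definition local_mul (a b c : G) (z : E * E) : E :=
  to_model (chart_at c)
    (lmul (of_model (chart_at a) z.1) (of_model (chart_at b) z.2)).

Definition local_mul_dom (a b c : G) : set (E * E) :=
  to_model (chart_at ((a, b) : prod_charted G G)) @`
    (dom (chart_at ((a, b) : prod_charted G G)) `&`
      (fun z => lmul z.1 z.2) @^-1` dom (chart_at c)).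

Lemma local_mul_smooth a b c : smooth_on (local_mul_dom a b c) (local_mul a b c).
Proof. exact: ((lmul_smooth G).2 (a, b) c). Qed.

Lemma open_local_mul_dom a b c : open (local_mul_dom a b c).
Proof.
apply: open_to_model; first by apply: is_chart_prod.
apply: open_comp; last by have [] := cG c.
by move=> z _; exact: (lmul_smooth G).1.
Qed.

Lemma local_mul_domP a b c g h : dom (chart_at a) g -> dom (chart_at b) h ->
  dom (chart_at c) (lmul g h) ->
  local_mul_dom a b c (to_model (chart_at a) g, to_model (chart_at b) h).
Proof. by move=> ag bh cgh; exists (g, h). Qed.

(** The right Maurer-Cartan form, read in the chart at g0. *)
Definition maurer_cartan (u : E) : 'L(E, E) :=
  clm_comp (Trinv (point_of u)) (tmap (point_of : vs_charted E -> G) u).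

Definition local_inv (u : E) : E :=
  to_model (chart_at (linv g0)) (linv (point_of u)).

Definition local_inv_dom : set E := to_model (chart_at g0) @`
  (dom (chart_at g0) `&` (@linv R E G) @^-1` dom (chart_at (linv g0))).

Lemma local_inv_smooth : smooth_on local_inv_dom local_inv.
Proof. exact: ((linv_smooth G).2 g0 (linv g0)). Qed.

Lemma open_local_inv_dom : open local_inv_dom.
Proof.
apply: open_to_model => //; apply: open_comp; last by have [] := cG (linv g0).
by move=> z _; exact: (linv_smooth G).1.
Qed.

Lemma local_inv_domP u : local_inv_dom u ->
  chart_image u /\ of_model (chart_at (linv g0)) (local_inv u) = linv (point_of u).
Proof.
move=> [g [Dg Dinv] <-]; split; first by exists g.
rewrite /local_inv point_ofK//.
by have [_ _ cK _ _] := cG (linv g0); rewrite cK.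
Qed.

Let K := local_mul g0 (linv g0) (lone G).
Let WK := local_mul_dom g0 (linv g0) (lone G).

(** The right translation by g^-1, read in charts, is w |-> K (w, i (u)) with i
the local inversion, so the Maurer-Cartan form is a partial derivative of the
smooth map K. *)
Lemma maurer_cartanE u : local_inv_dom u ->
  maurer_cartan u = clm_comp (frechet K (u, local_inv u)) (inl_clm E E) /\
  WK (u, local_inv u).
Proof.
move=> Iu; have [Uu invE] := local_inv_domP Iu.
have WKu : WK (u, local_inv u).
  rewrite -{1}(point_of_inv Uu) /local_inv.
  apply: local_mul_domP; first exact: dom_point_of.
    by case: Iu => g [Dg Dinv] <-; rewrite point_ofK.
  by rewrite lmulgV.
split=> //.
rewrite /maurer_cartan /Trinv -(tmap_comp (vs_atlas E) aG).
- rewrite /tmap /local_rep.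
  have -> : (rmul (linv (point_of u)) \o point_of) u = lone G by exact: lmulgV.
  rewrite -frechet_partial1; last first.
    exact: (smooth_on_differentiable (local_mul_smooth _ _ _)).
  congr frechet; apply/funext => w.
  by rewrite /K /local_mul /= invE.
- exact: mdifferentiable_point_of.
- exact: mdifferentiable_rmul.
Qed.

Lemma maurer_cartan_differentiable :
  differentiable maurer_cartan (to_model (chart_at g0) g0).
Proof.
set u0 := to_model (chart_at g0) g0.
have Iu0 : local_inv_dom u0 by exists g0 => //; split; exact: dG.
have [_ WKu0] := maurer_cartanE Iu0.
apply: (@differentiable_near _ _ _
   (fun u => clm_comp (frechet K (u, local_inv u)) (inl_clm E E))).
  by apply: open_near open_local_inv_dom Iu0 _ => u /maurer_cartanE[].
have dp : differentiable (fun u => (u, local_inv u)) u0.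
  apply: differentiable_pair => //.
  exact: (smooth_on_differentiable local_inv_smooth).
have dK : differentiable (frechet K) (u0, local_inv u0).
  exact: (smooth_on_differentiable (smooth_on_frechet (local_mul_smooth _ _ _))).
have dc := @differentiable_comp _ _ _ _ (fun u => (u, local_inv u)) (frechet K) u0 dp dK.
have [] := is_diff_bilin (bounded_bilinear_comp E (E * E)%type E) (frechetP dc)
  (is_diff_cst (inl_clm E E) u0).
by [].
Qed.

Lemma maurer_cartan_at : maurer_cartan (to_model (chart_at g0) g0) = Trinv g0.
Proof.
have -> : maurer_cartan (to_model (chart_at g0) g0) =
    clm_comp (Trinv (point_of (to_model (chart_at g0) g0))) (id_clm E).
  by congr clm_comp; exact: tmap_of_model.
by rewrite point_ofK//; apply: clm_eqP => v; rewrite clm_compE id_clmE.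
Qed.

End LocalRepresentation.

(** * The Lagrangian in a chart *)

Section LocalLagrangian.
Context {R : realType} {E : normedModType R} (G : lie_group E).
Variables (g0 : G) (L : GxE G -> R).
Hypothesis L_smooth : smooth_map (L : GxE G -> vs_charted R).

Let aG := lie_atlas G.
Let aGE := GxE_atlas G.
Let cG (g : G) : is_chart (chart_at g). Proof. by case: (aG.1 g). Qed.
Let dG (g : G) : dom (chart_at g) g. Proof. by case: (aG.1 g). Qed.
Let L_mdiff p : mdifferentiable (L : GxE G -> vs_charted R) p.
Proof. exact: (smooth_map_mdifferentiable aGE (vs_atlas _)). Qed.

Definition local_lagrangian (z : E * E) : R := L (point_of g0 z.1, z.2).
Definition local_momentum (z : E * E) : dual E := dL_dxi L (point_of g0 z.1) z.2.
Definition local_force (z : E * E) : dual E :=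
  Tr_dual (point_of g0 z.1) (dL_dg L (point_of g0 z.1) z.2).

Local Notation U := (chart_image g0).
Local Notation W := (config_image g0).
Local Notation l := local_lagrangian.

Lemma local_lagrangian_smooth : smooth_on W l.
Proof.
move=> k; have := L_smooth.2 (g0, 0) 0 k.
apply: Ck_onS => -[u x] [/= [g Dg <-] _]; exists (g, x) => //.
Qed.

Let l_diff z : W z -> differentiable l z.
Proof. exact: (smooth_on_differentiable local_lagrangian_smooth). Qed.

Let l_diff' u x : U u -> differentiable l (u, x).
Proof. by move=> Uu; exact: l_diff. Qed.

Lemma local_momentumE z : W z ->
  local_momentum z = clm_comp (frechet l z) (inr_clm E E).
Proof. by case: z => u x Wz; rewrite -frechet_partial2//; exact: l_diff. Qed.

Lemma local_momentum_smooth : smooth_on W local_momentum.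
Proof.
move=> k; have oW : open W by exact: open_config_image.
apply: (Ck_on_eq (f := fun z => clm_comp (frechet l z) (inr_clm E E))) => //.
  by move=> z Wz; rewrite local_momentumE.
apply: Ck_on_clm_comp => //; last exact: Ck_on_cst.
exact: smooth_on_frechet local_lagrangian_smooth k.
Qed.

Let e0 := to_model (chart_at (lone G)) (lone G).
Let M := local_mul (lone G) g0 g0.
Let WM := local_mul_dom (lone G) g0 g0.

Let WM_e0 u : U u -> WM (e0, u).
Proof.
move=> Uu; rewrite -{1}(point_of_inv Uu).
by apply: local_mul_domP; rewrite ?lmul1//; exact: dom_point_of.
Qed.

Let M_e0 u : U u -> M (e0, u) = u.
Proof.
move=> Uu; rewrite /M /local_mul (at_chartK aG) lmul1; exact: point_of_inv.
Qed.

(** Near the identity, h |-> L (h g, x) is the composite of the local Lagrangian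
and of the multiplication read in charts. As M (e0, u) = u, the chain rule
expresses the force by partial derivatives of smooth maps. *)
Lemma local_forceE z : W z ->
  local_force z = clm_comp (clm_comp (frechet l z) (inl_clm E E))
                           (clm_comp (frechet M (e0, z.1)) (inl_clm E E)).
Proof.
case: z => u x [/= Uu _].
have MD : differentiable M (e0, u).
  by apply: (smooth_on_differentiable (local_mul_smooth _ _ _)); exact: WM_e0.
rewrite -(frechet_partial1 MD) -(frechet_partial1 (l_diff' x Uu)).
have d1 : differentiable (fun w => M (w, u)) e0 by exact: differentiable_partial1.
have d2 : differentiable (fun u => l (u, x)) (M (e0, u)).
  by rewrite M_e0//; apply: differentiable_partial1; exact: l_diff'.
transitivity (frechet ((fun u => l (u, x)) \o (fun w => M (w, u))) e0); last first.
  apply: (etrans (frechet_comp d1 d2)).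
  have -> : M (e0, u) = u by exact: M_e0.
  by [].
pose F : G -> vs_charted R := fun h => L (h, x).
have dF h : mdifferentiable F h.
  exact: (mdifferentiable_comp aG aGE
    (mdifferentiable_pair1 aG h (x : vs_charted E)) (L_mdiff (h, x))).
rewrite /local_force /Tr_dual /dL_dg /Tr /=.
have := tmap_comp aG aG (mdifferentiable_rmul (point_of g0 u) (lone G)) (dF _).
have -> : rmul (point_of g0 u) (lone G) = point_of g0 u by exact: lmul1.
move=> <-; apply/esym/frechet_near; last exact: differentiable_comp.
have oWM : nbhs (e0, u) WM.
  by apply: open_nbhs_nbhs; split; [exact: open_local_mul_dom|exact: WM_e0].
have cu : (fun w => (w, u)) @ e0 --> (e0, u).
  by apply: cvg_pair; [exact: cvg_id|exact: cvg_cst].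
have : \forall w \near e0, WM (w, u) by exact: (cu _ oWM).
apply: filterS => w [[a b] [/= [Da Db] Dab] [aE bE]].
rewrite local_repE /= /F /rmul -aE /l /M /local_mul /= -bE.
have [_ _ eK _ _] := cG (lone G); rewrite !eK//.
have [_ _ bK _ _] := cG g0.
by rewrite /point_of bK// bK.
Qed.

Lemma local_force_smooth : smooth_on W local_force.
Proof.
move=> k; have oW : open W by exact: open_config_image.
pose s (z : E * E) := clm_comp (frechet M (e0, z.1)) (inl_clm E E).
apply: (Ck_on_eq (f := fun z => clm_comp (clm_comp (frechet l z) (inl_clm E E)) (s z))) => //.
  by move=> z Wz; rewrite local_forceE.
apply: Ck_on_clm_comp => //.
  apply: Ck_on_clm_comp => //; last exact: Ck_on_cst.
  exact: smooth_on_frechet local_lagrangian_smooth k.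
apply: Ck_on_clm_comp => //; last exact: Ck_on_cst.
have Mk : smooth_on W (fun z : E * E => (e0, z.1)).
  by move=> k'; apply: Ck_on_pair => //; [exact: Ck_on_cst|exact: Ck_on_fst].
have oWM : open WM by exact: open_local_mul_dom.
have := smooth_on_comp oW oWM (smooth_on_frechet (local_mul_smooth _ _ _)) Mk.
by move=> /(_ W); apply => // z [Uz _]; exact: WM_e0.
Qed.

(** T R_g and T R_(g^-1) cancel, which leaves the derivative of
u |-> L (phi^-1 u, x). *)
Lemma local_force_maurer_cartan z : W z ->
  clm_comp (local_force z) (maurer_cartan g0 z.1) =
  clm_comp (frechet l z) (inl_clm E E).
Proof.
case: z => u x [/= Uu _].
rewrite -(frechet_partial1 (l_diff' x Uu)).
pose F : G -> vs_charted R := fun h => L (h, x).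
have dF h : mdifferentiable F h.
  exact: (mdifferentiable_comp aG aGE
    (mdifferentiable_pair1 aG h (x : vs_charted E)) (L_mdiff (h, x))).
have := tmap_comp (vs_atlas E) aG (mdifferentiable_point_of Uu) (dF _).
move=> chain; apply: etrans (esym chain); rewrite /maurer_cartan.
apply: clm_eqP => v; rewrite !clm_compE; congr (clm_fun _ _); exact: TrK.
Qed.

End LocalLagrangian.

(** * The two-form in a chart *)

Section LocalOmega.
Context {R : realType} {E : normedModType R} (G : lie_group E).
Implicit Types (g : G) (xi : E) (mu nu : dual E).
Local Notation V := ((E * dual E) * (E * dual E))%type.
Local Notation base_point g := (to_model (chart_at g) g).

Lemma tmap_of_model_tulczyjew g0 mu xi nu (y w : V) : chart_image g0 y.1.1 ->
  tmap (of_model (chart_at (((g0, mu), (xi, nu)) : tulczyjew G)) :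
    vs_charted V -> tulczyjew G) y w =
  ((tmap (point_of g0 : vs_charted E -> G) y.1.1 w.1.1, w.1.2), w.2).
Proof.
case: y w => -[u m] [x n] [[wu wm] [wx wn]] /= Uu.
have [_ /frechetP d1] := mdifferentiable_point_of Uu.
have := is_diff_prod (is_diff_prod d1 (is_diff_id m))
  (is_diff_prod (is_diff_id x) (is_diff_id n)).
move=> /is_diff_frechetE H.
have := congr1 (fun f => f ((wu, wm), (wx, wn))) H.
by [].
Qed.

Lemma theta2_local g0 mu xi nu (y w : V) : chart_image g0 y.1.1 ->
  pullback (of_model (chart_at (((g0, mu), (xi, nu)) : tulczyjew G)) :
    vs_charted V -> tulczyjew G) (@theta2 R E G) y w =
  y.1.2 w.2.1 + y.2.2 (maurer_cartan g0 y.1.1 w.1.1).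
Proof.
move=> Uy; rewrite /pullback tmap_of_model_tulczyjew//.
case: y w Uy => -[u m] [x n] [[wu wm] [wx wn]] /= Uu.
apply: (etrans (theta2E _ _ _ _ _)); congr (_ + _).
by rewrite clm_compE.
Qed.

(** The coefficients of the one-form in the chart are m and n P (u); P is
differentiable at the base point of the chart, where it equals T R_(g^-1). *)
Lemma derive_theta2_local g0 mu xi nu (v w : V) :
  'D_v (pullback (of_model (chart_at (((g0, mu), (xi, nu)) : tulczyjew G)) :
    vs_charted V -> tulczyjew G) (@theta2 R E G) ^~ w)
    ((base_point g0, mu), (xi, nu)) =
  v.1.2 w.2.1 + (v.2.2 (Trinv g0 w.1.1) +
   nu (frechet (maurer_cartan g0) (base_point g0) v.1.1 w.1.1)).
Proof.
set y0 := ((base_point g0, mu), (xi, nu)).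
have nearE : \forall y \near y0,
    pullback (of_model (chart_at (((g0, mu), (xi, nu)) : tulczyjew G)) :
      vs_charted V -> tulczyjew G) (@theta2 R E G) y w =
    y.1.2 w.2.1 + y.2.2 (maurer_cartan g0 y.1.1 w.1.1).
  have : \forall y \near y0, chart_image g0 y.1.1.
    have c11 : (fun y : V => y.1.1) @ y0 --> y0.1.1.
      by apply: (@continuous_comp _ _ _ fst fst); exact: cvg_fst.
    apply: c11; apply: open_nbhs_nbhs; split; first exact: open_chart_image.
    exact: (image_chart_at (lie_atlas G)).
  by apply: filterS => y Uy; exact: theta2_local.
rewrite (near_eq_derive _ nearE).
have d1 : is_diff y0 (fun y : V => y.1) fst by exact: is_diff_fst.
have d2 : is_diff y0 (fun y : V => y.2) snd by exact: is_diff_snd.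
have d11 : is_diff y0 (fun y : V => y.1.1) (fun y => y.1.1).
  exact: is_diff_comp d1 (is_diff_fst _).
have d12 : is_diff y0 (fun y : V => y.1.2) (fun y => y.1.2).
  exact: is_diff_comp d1 (is_diff_snd _).
have d22 : is_diff y0 (fun y : V => y.2.2) (fun y => y.2.2).
  exact: is_diff_comp d2 (is_diff_snd _).
have dmc := is_diff_comp d11 (frechetP (maurer_cartan_differentiable g0)).
have dmcw := is_diff_bilin (bounded_bilinear_eval E E) dmc (is_diff_cst w.1.1 y0).
have dn := is_diff_bilin (bounded_bilinear_eval E R) d22 dmcw.
have dm := is_diff_bilin (bounded_bilinear_eval E R) d12 (is_diff_cst w.2.1 y0).
have D := is_diff_derive v (is_diffD dm dn).
apply: (etrans (@derive_val _ _ _ _ _ _ _ D)).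
rewrite -(maurer_cartan_at g0).
set P := maurer_cartan g0 _; set D' := frechet (maurer_cartan g0) _.
(* the two terms at 0 come from the constant vector w *)
rewrite -[LHS]/(v.1.2 w.2.1 + mu 0 + (v.2.2 (P w.1.1) + nu (D' v.1.1 w.1.1 + P 0))).
by rewrite (clm0 mu) (clm0 P) !addr0.
Qed.

Lemma OmegaE g0 mu xi nu (v w : V) :
  Omega (((g0, mu), (xi, nu)) : tulczyjew G) v w =
  v.1.2 w.2.1 + (v.2.2 (Trinv g0 w.1.1) +
   nu (frechet (maurer_cartan g0) (base_point g0) v.1.1 w.1.1)) -
  (w.1.2 v.2.1 + (w.2.2 (Trinv g0 v.1.1) +
   nu (frechet (maurer_cartan g0) (base_point g0) w.1.1 v.1.1))).
Proof.
by rewrite -(derive_theta2_local g0 mu xi nu v w) -(derive_theta2_local g0 mu xi nu w v).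
Qed.

Section Isotropy.
Variables (g0 : G) (xi0 : E) (L : GxE G -> R).
Hypothesis L_smooth : smooth_map (L : GxE G -> vs_charted R).

Local Notation z0 := (base_point g0, xi0).
Local Notation l := (local_lagrangian g0 L).

Let W0 : config_image g0 z0.
Proof. by split => //; exact: (image_chart_at (lie_atlas G)). Qed.

Let oW : open (config_image g0).
Proof. exact: open_config_image. Qed.

Let D2 := frechet (frechet l) z0.

Let D2_diff : is_diff z0 (frechet l) D2.
Proof.
apply: frechetP.
exact: (smooth_on_differentiable (smooth_on_frechet (local_lagrangian_smooth g0 L_smooth))).
Qed.

Lemma frechet_local_momentum (z : E * E) b :
  frechet (local_momentum g0 L) z0 z b = D2 z (0, b).
Proof.
have H := is_diff_bilin (bounded_bilinear_comp E (E * E)%type R) D2_diff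
  (is_diff_cst (inr_clm E E) z0).
have nE : \forall z \near z0,
    clm_comp (frechet l z) (inr_clm E E) = local_momentum g0 L z.
  apply: open_near oW W0 _ => z' Wz.
  by rewrite local_momentumE.
have /is_diff_frechetE -> := is_diff_near nE H.
rewrite clm_addE !clm_compE inr_clmE.
by rewrite -[RHS]addr0; congr (_ + _); exact: clm0.
Qed.

(** The derivative of B (u, x) o P (u) = d_1 l at the base point. *)
Lemma frechet_local_force (z : E * E) a :
  frechet (local_force g0 L) z0 z (Trinv g0 a) +
  local_force g0 L z0 (frechet (maurer_cartan g0) (base_point g0) z.1 a) =
  D2 z (a, 0).
Proof.
have dB : differentiable (local_force g0 L) z0.
  exact: (smooth_on_differentiable (local_force_smooth g0 L_smooth)).
have dmc := is_diff_comp (is_diff_fst z0) (frechetP (maurer_cartan_differentiable g0)).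
have HB := is_diff_bilin (bounded_bilinear_comp E E R) (frechetP dB) dmc.
have Hl := is_diff_bilin (bounded_bilinear_comp E (E * E)%type R) D2_diff
  (is_diff_cst (inl_clm E E) z0).
have nE : \forall z \near z0, clm_comp (frechet l z) (inl_clm E E) =
    clm_comp (local_force g0 L z) (maurer_cartan g0 z.1).
  apply: open_near oW W0 _ => z' Wz.
  by rewrite local_force_maurer_cartan.
have /is_diff_frechetE Hl' := is_diff_near nE Hl.
have /is_diff_frechetE HB' := HB.
have : clm_comp (frechet (local_force g0 L) z0 z) (maurer_cartan g0 (base_point g0)) +
    clm_comp (local_force g0 L z0) (frechet (maurer_cartan g0) (base_point g0) z.1) =
    clm_comp (D2 z) (inl_clm E E) + clm_comp (frechet l z0) 0.
  have H := congr1 (fun f : E * E -> dual E => f z) (etrans (esym HB') Hl').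
  by apply: etrans (etrans _ H) _.
rewrite maurer_cartan_at; move: (local_force g0 L z0) => nu.
move=> /(congr1 (fun A : dual E => A a)); rewrite !clm_addE !clm_compE inl_clmE => ->.
by rewrite -[RHS]addr0; congr (_ + _); exact: clm0.
Qed.

(** The tangent space of S: the graph of the derivative of (A, B). *)
Definition lagrangian_tangent (v : V) :=
  v.1.2 = frechet (local_momentum g0 L) z0 (v.1.1, v.2.1) /\
  v.2.2 = frechet (local_force g0 L) z0 (v.1.1, v.2.1).

(** By the derivatives of A = d_2 l and B o P = d_1 l, the first half of Omega
on v and w is the second derivative of l at the base components of v and w, and
the second half is the same with v and w exchanged. *)
Lemma lagrangian_tangent_isotropic mu (v w : V) :
  lagrangian_tangent v -> lagrangian_tangent w ->
  Omega (((g0, mu), (xi0, local_force g0 L z0)) : tulczyjew G) v w = 0.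
Proof.
move=> [v1 v2] [w1 w2]; rewrite OmegaE v1 v2 w1 w2.
have split2 (z : E * E) a b : D2 z (0, b) + D2 z (a, 0) = D2 z (a, b).
  by rewrite -linearD; congr (clm_fun _ _); congr (_, _); rewrite /= ?addr0 ?add0r.
rewrite (frechet_local_force (v.1.1, v.2.1) w.1.1).
rewrite (frechet_local_force (w.1.1, w.2.1) v.1.1).
rewrite !frechet_local_momentum !split2.
have C2 := @local_lagrangian_smooth R E G g0 L L_smooth 2.
by rewrite (second_derivative_sym _ _ oW W0 C2) subrr.
Qed.

(** The tangent vector with the base components of v is orthogonal to the tangent
space too, by isotropy. In the difference with v only the pairings of the
fibre components with w_x and P w_u remain. *)
Lemma lagrangian_tangent_maximal mu (v : V) :
  (forall w, lagrangian_tangent w ->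
    Omega (((g0, mu), (xi0, local_force g0 L z0)) : tulczyjew G) v w = 0) ->
  lagrangian_tangent v.
Proof.
move=> vO.
pose graph (a b : E) : V :=
  ((a, frechet (local_momentum g0 L) z0 (a, b)),
   (b, frechet (local_force g0 L) z0 (a, b))).
have Tg a b : lagrangian_tangent (graph a b) by [].
have key a b : v.1.2 b + v.2.2 (Trinv g0 a) =
    (graph v.1.1 v.2.1).1.2 b + (graph v.1.1 v.2.1).2.2 (Trinv g0 a).
  have := vO _ (Tg a b).
  have := lagrangian_tangent_isotropic mu (Tg v.1.1 v.2.1) (Tg a b).
  rewrite !OmegaE /=.
  have alg (x y x' y' p q : R) : x + (y + p) - q = 0 -> x' + (y' + p) - q = 0 ->
      x' + y' = x + y.
    by move=> h1 h2; apply/eqP; rewrite -subr_eq0; apply/eqP;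
       rewrite -[RHS](subrr (0 : R)) -{1}h2 -h1; ring.
  exact: alg.
exact: (dual_pair_inj (TrinvK g0) key).
Qed.

End Isotropy.
End LocalOmega.

(** * S as a Lagrangian submanifold *)

Section LagrangianSubmanifold.
Context {R : realType} {E : normedModType R} (G : lie_group E) (L : GxE G -> R).
Hypothesis L_smooth : smooth_map (L : GxE G -> vs_charted R).
Local Notation V := ((E * dual E) * (E * dual E))%type.
Local Notation base_point g := (to_model (chart_at g) g).

Definition momentum_proj : 'L(V, V) := clm_of (fun y => ((0, y.1.2), (0, y.2.2))).

Lemma momentum_projE y : momentum_proj y = ((0, y.1.2), (0, y.2.2)).
Proof.
rewrite /momentum_proj (@bounded_clm_of _ _ _ _ 1)//.
  move=> a u v; rewrite -[RHS]/((a *: 0 + 0, a *: u.1.2 + v.1.2),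
                               (a *: 0 + 0, a *: u.2.2 + v.2.2)).
  by rewrite scaler0 addr0.
move=> u; rewrite mul1r !prod_normE /= !normr0 !ge_max !le_max !lexx !normr_ge0.
by rewrite !orbT.
Qed.

Section AtPoint.
Variable g0 : G.

Definition lagrangian_graph (y : V) : V :=
  ((0, local_momentum g0 L (y.1.1, y.2.1)), (0, local_force g0 L (y.1.1, y.2.1))).

Lemma chart_image_tulczyjew mu xi nu (y : V) :
  (to_model (chart_at (((g0, mu), (xi, nu)) : tulczyjew G)) @`
     dom (chart_at (((g0, mu), (xi, nu)) : tulczyjew G))) y <->
  chart_image g0 y.1.1.
Proof.
split=> [[[[g m] [x n]] [/= [Dg _] _] <-]|]; first by exists g.
case: y => -[u m] [x n] [g Dg /= <-]; exists ((g, m), (x, n)) => //.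
Qed.

Lemma lagrangian_chart_graph mu xi nu :
  chart_graph (lagrangian_set L) (((g0, mu), (xi, nu)) : tulczyjew G)
    momentum_proj lagrangian_graph.
Proof.
split.
- by move=> v; rewrite !momentum_projE.
- by move=> y; rewrite momentum_projE.
- move=> [[u m] [x n]] w; rewrite momentum_projE /lagrangian_graph /=.
  by rewrite !addr0.
- move=> y w /chart_image_tulczyjew Uy; apply/chart_image_tulczyjew.
  by rewrite momentum_projE /= addr0.
- have sub : to_model (chart_at (((g0, mu), (xi, nu)) : tulczyjew G)) @`
     dom (chart_at (((g0, mu), (xi, nu)) : tulczyjew G)) `<=`
     config_proj @^-1` config_image g0.
    by move=> y /chart_image_tulczyjew Uy; rewrite /preimage /= config_projE; split.
  have oW : open (config_image g0) by exact: open_config_image.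
  have oW' : open (config_proj @^-1` config_image g0).
    by apply: open_comp => // y _; exact: clm_continuous.
  have Cc (F : normedModType R) (f : E * E -> F) : smooth_on (config_image g0) f ->
      smooth_on (config_proj @^-1` config_image g0) (fun y : V => f (y.1.1, y.2.1)).
    move=> Cf k.
    apply: (@Ck_on_eq _ _ _ _ _ (f \o config_proj)) => //.
      by move=> y _ /=; rewrite config_projE.
    apply: (smooth_on_comp oW' oW Cf) => // k'; exact: Ck_on_clm.
  move=> k; apply: (Ck_onS sub); do 2 ?apply: Ck_on_pair => //; try exact: Ck_on_cst.
    exact: (Cc _ _ (local_momentum_smooth g0 L_smooth)).
  exact: (Cc _ _ (local_force_smooth g0 L_smooth)).
- move=> [[g m] [x n]] [/= [Dg _] _].
  rewrite momentum_projE /lagrangian_graph /local_momentum /local_force /=.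
  rewrite point_ofK//.
  split=> [/(lagrangian_setP L_smooth)[-> ->]//|[H1 H2]].
  exact/(lagrangian_setP L_smooth).
Qed.

Lemma lagrangian_graph_tangent mu xi nu (v : V) :
  momentum_proj v =
    frechet lagrangian_graph ((base_point g0, mu), (xi, nu)) v <->
  lagrangian_tangent g0 xi L v.
Proof.
set y0 := ((base_point g0, mu), (xi, nu)).
have W0 : config_image g0 (base_point g0, xi).
  by split => //; exact: (image_chart_at (lie_atlas G)).
have dc : is_diff y0 (fun y : V => (y.1.1, y.2.1)) (fun y : V => (y.1.1, y.2.1)).
  have -> : (fun y : V => (y.1.1, y.2.1)) = config_proj.
    by apply/funext => y; rewrite config_projE.
  exact: is_diff_clm.
have dA := is_diff_comp dc (frechetP
  (smooth_on_differentiable (local_momentum_smooth g0 L_smooth) W0)).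
have dB := is_diff_comp dc (frechetP
  (smooth_on_differentiable (local_force_smooth g0 L_smooth) W0)).
have := is_diff_pair (is_diff_pair (is_diff_cst (0 : E) y0) dA)
  (is_diff_pair (is_diff_cst (0 : E) y0) dB).
move=> /is_diff_frechetE /(congr1 (fun h : V -> V => h v)) H.
have mE := momentum_projE v; split=> [Hv|[v1 v2]].
  have [h1 h2] := etrans (esym mE) (etrans Hv H).
  by split; [exact: h1|exact: h2].
by apply: (etrans mE (etrans _ (esym H))) => /=; rewrite v1 v2.
Qed.

End AtPoint.

Lemma lagrangian_set_lagrangian : is_lagrangian (@Omega R E G) (lagrangian_set L).
Proof.
have aT := tulczyjew_atlas G.
split=> [[[g mu] [xi nu]] Sp|[[g mu] [xi nu]] Sp].
  exact: (chart_graph_straighten aT (lagrangian_chart_graph g mu xi nu)).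
have -> : tangent_to (lagrangian_set L) (((g, mu), (xi, nu)) : tulczyjew G) =
    [set v | lagrangian_tangent g xi L v].
  rewrite (chart_graph_tangent aT (lagrangian_chart_graph g mu xi nu) Sp).
  apply/seteqP; split=> v; first exact: (lagrangian_graph_tangent g mu xi nu v).1.
  exact: (lagrangian_graph_tangent g mu xi nu v).2.
have -> : nu = local_force g L (base_point g, xi).
  have [_ ->] := (lagrangian_setP L_smooth _ _ _ _).1 Sp.
  by rewrite /local_force point_ofK//; exact: ((lie_atlas G).1 g).2.
apply/seteqP; split=> v /=.
  by move=> Tv w Tw; exact: (lagrangian_tangent_isotropic L_smooth mu Tv Tw).
exact: (lagrangian_tangent_maximal L_smooth (mu := mu)).
Qed.

End LagrangianSubmanifold.

Theorem mainTheorem3 (R : realType) (E : completeNormedModType R)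
    (G : lie_group E) (E_reflexive : reflexive_space E)
    (L : GxE G -> R) (L_smooth : smooth_map (L : GxE G -> vs_charted R)) :
  is_lagrangian (@Omega R E G) (lagrangian_set L) /\
  forall (I : set R) (g : R -> G) (mu : R -> dual E),
    open I -> is_interval I ->
    (forall t, I t -> mdifferentiable (g : vs_charted R -> G) t) ->
    (forall t, I t ->
       mdifferentiable (mu : vs_charted R -> vs_charted (dual E)) t) ->
    let xi t := Trinv (g t) (velocity g t) in
    (forall t, I t ->
       lagrangian_set L
         (trivialization (g t, mu t)
            (velocity g t, velocity (mu : R -> vs_charted (dual E)) t))) <->
    (forall t, I t -> mu t = dL_dxi L (g t) (xi t)) /\
    (forall t, I t ->
       is_derive t 1 (fun s => dL_dxi L (g s) (xi s))
         (Tr_dual (g t) (dL_dg L (g t) (xi t))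
          + ad_star G (xi t) (dL_dxi L (g t) (xi t)))).
Proof.
split; first exact: lagrangian_set_lagrangian.
by move=> I g mu oI _ _ dmu; exact: lagrangian_set_velocity.
Qed.
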